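(* Let $G$ be a countable discrete group that acts on a discrete set $X$, and let $E\subseteq X$ be a non-empty subset. Then the following conditions are equivalent: (i) $E$ is $G$-paradoxical. (ii) For every tracial weight $\varphi\colon(\ell^\infty(X)\rtimes_r G)^+\to[0,\infty]$, the value of $\varphi(1_E)$ is either $0$ or $\infty$. (iii) $1_E$ is properly infinite in $\ell^\infty(X)\rtimes_r G$. (iv) The $n$-fold direct sum $1_E\oplus 1_E\oplus\cdots\oplus 1_E$ is properly infinite in $M_n(\ell^\infty(X)\rtimes_r G)$ for some $n$.
   Context: $\ell^\infty(X)\rtimes_r G$ is the reduced crossed product for the action of $G$ on $\ell^\infty(X)$ induced by the action on $X$; $1_E\in\ell^\infty(X)$ is the characteristic function of $E$. A non-empty set $E\subseteq X$ is $G$-paradoxical if there exist non-empty subsets $V_1,\dots,V_{n+m}$ of $X$ and elements $t_1,\dots,t_{n+m}\in G$ such that $\bigcup_{i=1}^nV_i=\bigcup_{i=n+1}^{n+m}V_i=E$ and such that the sets $(t_k.V_k)_{k=1}^{n+m}$ are pairwise disjoint subsets of $E$. A tracial weight on a $C^*$-algebra $B$ is a map $\varphi\colon B^+\to[0,\infty]$ on the positive cone satisfying $\varphi(\alpha a+\beta b)=\alpha\varphi(a)+\beta\varphi(b)$ and $\varphi(x^*x)=\varphi(xx^* )$ for all $a,b\in B^+$, all $\alpha,\beta\in\mathbb{R}^+$ and all $x\in B$ (with $0\cdot\infty=0$). A non-zero projection $p$ in a $C^*$-algebra $B$ is properly infinite if there exist partial isometries $x,y\in B$ with $x^*x=y^*y=p$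 and $xx^*+yy^*\le p$. *)

(* Defs.v *)
From HB Require Import structures.
From mathcomp Require Import all_boot all_order all_algebra.
From mathcomp Require Import mathcomp_extra boolp classical_sets functions.
From mathcomp Require Import cardinality fsbigop reals constructive_ereal ereal.
From mathcomp Require Import esum numfun.
From mathcomp Require Import complex.
From mathcomp Require Import ring lra.

Set Implicit Arguments.
Unset Strict Implicit.
Unset Printing Implicit Defensive.

Import Order.TTheory GRing.Theory Num.Theory.
Import ComplexField.Normc.

Local Open Scope classical_set_scope.
Local Open Scope ring_scope.

(* Rings with involution. Positivity, projections and proper infiniteness in a
   C*-algebra only depend on the underlying *-ring; stating them at this level
   makes them apply both to a C*-algebra B and to M_n(B), i.e. 'M[B]_n with the
   conjugate-transpose involution. *)
HB.mixin Record PzRing_isStarRing A of GRing.PzRing A := {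
  star : A -> A;
  starK : involutive star;
  starD : {morph star : x y / x + y};
  starM : forall x y, star (x * y) = star y * star x
}.

#[short(type="starRingType")]
HB.structure Definition StarRing := {A of PzRing_isStarRing A & GRing.PzRing A}.

Section MatrixStar.
Variables (A : starRingType) (n : nat).
Implicit Types x y : 'M[A]_n.

Definition mxstar x : 'M[A]_n := \matrix_(i, j) star (x j i).

Fact mxstarK : involutive mxstar.
Proof. by move=> x; apply/matrixP => i j; rewrite !mxE starK. Qed.

Fact mxstarD : {morph mxstar : x y / x + y}.
Proof. by move=> x y; apply/matrixP => i j; rewrite !mxE starD. Qed.

Fact mxstarM x y : mxstar (x * y) = mxstar y * mxstar x.
Proof.
apply/matrixP => i j; rewrite !mxE.
have s0 : star 0 = 0 :> A by apply: (addrI (star 0)); rewrite -starD !addr0.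
rewrite (big_morph star (@starD A) s0); apply: eq_bigr => k _.
by rewrite !mxE starM.
Qed.

HB.instance Definition _ :=
  PzRing_isStarRing.Build 'M[A]_n mxstarK mxstarD mxstarM.
End MatrixStar.

Section StarRingNotions.
Variable A : starRingType.
Implicit Types a b p x y : A.

(* The positive cone of a C*-algebra is the set of all b^* b. *)
Definition is_positive a := exists b, a = star b * b.
Definition star_le a b := is_positive (b - a).
Definition projection p := star p = p /\ p * p = p.
Definition partial_isometry x := projection (star x * x).
Definition properly_infinite p :=
  [/\ projection p, p != 0 &
      exists x y, [/\ partial_isometry x, partial_isometry y,
        star x * x = p, star y * y = p &
        star_le (x * star x + y * star y) p]].
End StarRingNotions.

Section RealSum.
Context {R : realType} {I : choiceType}.
Implicit Types (u v : I -> R) (c : R).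

Definition abs_summable u := summable [set: I] (fun i => (u i)%:E).

(* The sum of u over I, meaningful when u is absolutely summable. *)
Definition rsum u : R :=
  fine (\esum_(i in [set: I]) (Num.max (u i) 0)%:E) -
  fine (\esum_(i in [set: I]) (Num.max (- u i) 0)%:E).

Lemma le_abs_summable u v :
  (forall i, `|u i| <= v i) -> abs_summable v -> abs_summable u.
Proof.
move=> uv; apply: le_lt_trans; apply: le_esum => i _.
by rewrite lee_fin (le_trans (uv i))// ler_norm.
Qed.

Lemma abs_summableD u v :
  abs_summable u -> abs_summable v -> abs_summable (fun i => u i + v i).
Proof. exact: summableD. Qed.

Lemma abs_summableN u : abs_summable u -> abs_summable (fun i => - u i).
Proof. by apply: le_lt_trans; apply: le_esum => i _; rewrite lee_fin normrN. Qed.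

Lemma abs_summable_max u : abs_summable u -> abs_summable (fun i => Num.max (u i) 0).
Proof.
move=> su; have nu : abs_summable (fun i => `|u i|).
  by move: su; apply: le_lt_trans; apply: le_esum => i _; rewrite lee_fin normr_id.
by apply: le_abs_summable nu => i; case: (ltP (u i) 0) => ?; rewrite ?normr0.
Qed.

Lemma esum_scale_le c u : 0 <= c -> (forall i, 0 <= u i) ->
  (\esum_(i in [set: I]) (c * u i)%:E <= c%:E * \esum_(i in [set: I]) (u i)%:E)%E.
Proof.
move=> c0 u0; apply: ge_ereal_sup => _ [F [finF _] <-].
under eq_fsbigr do rewrite EFinM.
rewrite -ge0_mule_fsumr; last by move=> i; rewrite lee_fin.
by apply: lee_wpmul2l; [rewrite lee_fin|apply: ereal_sup_ubound; exists F].
Qed.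

Lemma abs_summableZ c u : abs_summable u -> abs_summable (fun i => c * u i).
Proof.
rewrite /abs_summable /summable => su.
rewrite (@eq_esum _ _ _ _ (fun i => (`|c| * `|u i|)%:E)); last first.
  by move=> i _; rewrite /= normrM.
apply: le_lt_trans (esum_scale_le _ _) _ => //.
by rewrite lte_mul_pinfty// lee_fin.
Qed.

Let fin u : (forall i, 0 <= u i) -> abs_summable u ->
  (\esum_(i in [set: I]) (u i)%:E \is a fin_num)%E.
Proof.
move=> u0; rewrite /abs_summable summableE.
by under eq_esum do rewrite gee0_abs ?lee_fin//.
Qed.

Lemma rsumE u p q : (forall i, 0 <= p i) -> (forall i, 0 <= q i) ->
  abs_summable p -> abs_summable q -> (forall i, u i = p i - q i) ->
  rsum u = fine (\esum_(i in [set: I]) (p i)%:E) -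
           fine (\esum_(i in [set: I]) (q i)%:E).
Proof.
move=> p0 q0 sp sq upq; rewrite /rsum.
have su : abs_summable u.
  have -> : u = (fun i => p i + - q i) by apply/funext.
  by apply: abs_summableD => //; exact: abs_summableN.
have s1 := abs_summable_max su; have s2 := abs_summable_max (abs_summableN su).
have m1 i : 0 <= Num.max (u i) 0 by rewrite le_max lexx orbT.
have m2 i : 0 <= Num.max (- u i) 0 by rewrite le_max lexx orbT.
suff : (\esum_(i in [set: I]) (Num.max (u i) 0)%:E + \esum_(i in [set: I]) (q i)%:E =
  \esum_(i in [set: I]) (p i)%:E + \esum_(i in [set: I]) (Num.max (- u i) 0)%:E)%E.
  by move/(congr1 fine); rewrite !fineD ?fin// => h; lra.
rewrite -!esumD; try by move=> *; rewrite lee_fin.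
apply: eq_esum => i _; rewrite -!EFinD; congr EFin.
by rewrite upq; case: (leP (p i - q i) 0); case: (leP (- (p i - q i)) 0); lra.
Qed.

Let max0 (x : R) : 0 <= Num.max x 0. Proof. by rewrite le_max lexx orbT. Qed.

Lemma rsum_ge0E u : (forall i, 0 <= u i) -> abs_summable u ->
  rsum u = fine (\esum_(i in [set: I]) (u i)%:E).
Proof.
move=> u0 su; rewrite (@rsumE u u (fun=> 0))//.
- by rewrite [X in _ - fine X]esum1//= subr0.
- by rewrite /abs_summable /summable esum1// => i _; rewrite abse0.
- by move=> i; rewrite subr0.
Qed.

Lemma rsumD u v : abs_summable u -> abs_summable v ->
  rsum (fun i => u i + v i) = rsum u + rsum v.
Proof.
move=> su sv; have [sNu sNv] := (abs_summableN su, abs_summableN sv).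
have [? ?] := (abs_summable_max su, abs_summable_max sv).
have [? ?] := (abs_summable_max sNu, abs_summable_max sNv).
rewrite (@rsumE _ (fun i => Num.max (u i) 0 + Num.max (v i) 0)
  (fun i => Num.max (- u i) 0 + Num.max (- v i) 0)); first last.
- move=> i; case: (leP (u i) 0); case: (leP (- u i) 0);
    by case: (leP (v i) 0); case: (leP (- v i) 0); lra.
- exact: abs_summableD.
- exact: abs_summableD.
- by move=> i; rewrite addr_ge0.
- by move=> i; rewrite addr_ge0.
under eq_esum do rewrite EFinD.
under [in X in _ - X = _]eq_esum do rewrite EFinD.
rewrite !esumD; try by move=> *; rewrite lee_fin.
by rewrite !fineD ?fin// /rsum; lra.
Qed.

Lemma rsumN u : rsum (fun i => - u i) = - rsum u.
Proof.
rewrite /rsum opprB; congr (_ - fine _).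
by apply: eq_esum => i _; rewrite opprK.
Qed.

Lemma ge0_rsum u : (forall i, 0 <= u i) -> 0 <= rsum u.
Proof.
move=> u0; rewrite /rsum [X in _ - fine X]esum1/= ?subr0.
  by apply: fine_ge0; apply: esum_ge0 => i _; rewrite lee_fin.
by move=> i _; congr EFin; apply/max_idPr; rewrite oppr_le0.
Qed.

Lemma le_rsum u v : abs_summable u -> abs_summable v ->
  (forall i, u i <= v i) -> rsum u <= rsum v.
Proof.
move=> su sv uv; rewrite -subr_ge0 -rsumN -rsumD//; last exact: abs_summableN.
by apply: ge0_rsum => i; rewrite subr_ge0.
Qed.

Let ge0_rsumZ_le c u : 0 <= c -> (forall i, 0 <= u i) -> abs_summable u ->
  rsum (fun i => c * u i) <= c * rsum u.
Proof.
move=> c0 u0 su; rewrite !rsum_ge0E//; first last.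
- exact: abs_summableZ.
- by move=> i; rewrite mulr_ge0.
rewrite -lee_fin EFinM !fineK ?fin//; first exact: esum_scale_le.
- by move=> i; rewrite mulr_ge0.
- exact: abs_summableZ.
Qed.

Let ge0_rsumZ c u : 0 <= c -> (forall i, 0 <= u i) -> abs_summable u ->
  rsum (fun i => c * u i) = c * rsum u.
Proof.
move=> c0 u0 su; apply/eqP; rewrite eq_le ge0_rsumZ_le//=.
have [->|cn0] := eqVneq c 0.
  by rewrite mul0r; apply: ge0_rsum => i; rewrite mul0r.
have cp : 0 < c by rewrite lt_neqAle eq_sym cn0.
rewrite -ler_pdivlMl//.
have {1}-> : u = (fun i => c^-1 * (c * u i)) by apply/funext => i; rewrite mulKf.
apply: ge0_rsumZ_le; rewrite ?invr_ge0//; first by move=> i; rewrite mulr_ge0.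
exact: abs_summableZ.
Qed.

Lemma rsumZ c u : abs_summable u -> rsum (fun i => c * u i) = c * rsum u.
Proof.
move=> su; wlog c0 : c / 0 <= c => [H|].
  have [/H//|c0] := leP 0 c.
  rewrite -[LHS]opprK -rsumN; under eq_fun do rewrite -mulNr.
  by rewrite H ?oppr_ge0 ?ltW// mulNr opprK.
have sp := abs_summable_max su; have sn := abs_summable_max (abs_summableN su).
have uE : u = (fun i => Num.max (u i) 0 + - Num.max (- u i) 0).
  by apply/funext => i; case: (leP (u i) 0); case: (leP (- u i) 0); lra.
rewrite [in RHS]uE rsumD//; last exact: abs_summableN.
rewrite rsumN mulrBr -!ge0_rsumZ// -rsumN -rsumD; first last.
- by apply: abs_summableN; apply: abs_summableZ.
- by apply: abs_summableZ.
by congr rsum; apply/funext => i; rewrite {1}uE; lra.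
Qed.

Lemma rsum_reindex (s : I -> I) u : bijective s -> rsum (u \o s) = rsum u.
Proof.
move=> bs; have bij : set_bij [set: I] [set: I] s.
  by rewrite setTT_bijective.
by rewrite /rsum; congr (fine _ - fine _); symmetry; exact: reindex_esum bij.
Qed.

Lemma abs_summable_reindex (s : I -> I) u :
  bijective s -> abs_summable u -> abs_summable (u \o s).
Proof.
move=> bs; have bij : set_bij [set: I] [set: I] s by rewrite setTT_bijective.
by rewrite /abs_summable /summable (reindex_esum _ _ _ _ bij).
Qed.

End RealSum.

Section ComplexFacts.
Context {R : rcfType}.
Implicit Types z w : R[i].

Lemma normc_ge0 z : 0 <= normc z.
Proof. by case: z => a b; exact: sqrtr_ge0. Qed.

Lemma sqr_normcE z : normc z ^+ 2 = complex.Re z ^+ 2 + complex.Im z ^+ 2.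
Proof. by case: z => a b /=; rewrite sqr_sqrtr// addr_ge0 ?sqr_ge0. Qed.

Lemma normc_conj z : normc z^* = normc z.
Proof. by case: z => a b /=; rewrite sqrrN. Qed.

Lemma sqr_normcD z w : normc (z + w) ^+ 2 <= 2 * (normc z ^+ 2 + normc w ^+ 2).
Proof.
rewrite !sqr_normcE; case: z w => [a b] [c d] /=.
have := sqr_ge0 (a - c); have := sqr_ge0 (b - d).
by rewrite !expr2; nra.
Qed.

Lemma normcN z : normc (- z) = normc z.
Proof. by case: z => a b /=; rewrite !sqrrN. Qed.

Lemma Re_mulJ_le z w (t : R) : 0 < t ->
  2 * complex.Re (z * w^*) <= t^-1 * normc z ^+ 2 + t * normc w ^+ 2.
Proof.
move=> t0; rewrite !sqr_normcE; case: z w => [a b] [c d] /=.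
rewrite -(ler_pM2l t0) [leRHS]mulrDr mulVKf ?gt_eqF//.
have := sqr_ge0 (a - t * c); have := sqr_ge0 (b - t * d).
by rewrite !expr2; nra.
Qed.

Lemma abs_Re_mulJ_le z w :
  `|complex.Re (z * w^*)| <= normc z ^+ 2 + normc w ^+ 2.
Proof.
rewrite !sqr_normcE; case: z w => [a b] [c d] /=; rewrite ler_norml.
have := sqr_ge0 (a - c); have := sqr_ge0 (b - d).
have := sqr_ge0 (a + c); have := sqr_ge0 (b + d).
by rewrite !expr2 => *; apply/andP; split; nra.
Qed.

Lemma abs_Im_mulJ_le z w :
  `|complex.Im (z * w^*)| <= normc z ^+ 2 + normc w ^+ 2.
Proof.
rewrite !sqr_normcE; case: z w => [a b] [c d] /=; rewrite ler_norml.
have := sqr_ge0 (a - d); have := sqr_ge0 (b - c).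
have := sqr_ge0 (a + d); have := sqr_ge0 (b + c).
by rewrite !expr2 => *; apply/andP; split; nra.
Qed.

Lemma ReD z w : complex.Re (z + w) = complex.Re z + complex.Re w.
Proof. by case: z w => [a b] [c d]. Qed.
Lemma ImD z w : complex.Im (z + w) = complex.Im z + complex.Im w.
Proof. by case: z w => [a b] [c d]. Qed.
Lemma conjcD z w : (z + w)^* = z^* + w^*.
Proof. exact: rmorphD. Qed.
Lemma conjcN z : (- z)^* = - z^*.
Proof. exact: rmorphN. Qed.
Lemma conjcM z w : (z * w)^* = z^* * w^*.
Proof. exact: rmorphM. Qed.
End ComplexFacts.

Section L2.
Context {R : realType} {I : choiceType}.

Definition square_summable : {pred I -> R[i]} :=
  fun x => `[< abs_summable (fun i => normc (x i) ^+ 2) >].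

Fact square_summable_submod : submod_closed square_summable.
Proof.
split.
  rewrite unfold_in; apply/asboolP; rewrite /abs_summable /summable esum1// => i _.
  by rewrite normc0 expr0n/= normr0.
move=> a x y /asboolP sx /asboolP sy; apply/asboolP.
apply: (@le_abs_summable _ _ _
  (fun i => 2 * (normc a ^+ 2 * normc (x i) ^+ 2 + normc (y i) ^+ 2))).
  move=> i; rewrite ger0_norm ?sqr_ge0// -exprMn -normcM; exact: sqr_normcD.
apply: abs_summableZ; apply: abs_summableD => //; exact: abs_summableZ.
Qed.

HB.instance Definition _ := GRing.isSubmodClosed.Build R[i] (I -> R[i])
  square_summable square_summable_submod.

End L2.

Record l2 (R : realType) (I : choiceType) := L2 {
  l2_fun :> I -> R[i];
  l2_summable : l2_fun \in @square_summable R I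
}.

Section L2Space.
Context {R : realType} {I : choiceType}.

HB.instance Definition _ := [isSub for @l2_fun R I].
HB.instance Definition _ := [Choice of l2 R I by <:].
HB.instance Definition _ := [SubChoice_isSubLmodule of l2 R I by <:].

Implicit Types x y z : l2 R I.

Lemma l2D x y i : (x + y) i = x i + y i. Proof. by []. Qed.
Lemma l2Z a x i : (a *: x) i = a * x i. Proof. by []. Qed.
Lemma l2N x i : (- x) i = - x i. Proof. by []. Qed.

Lemma l2P x y : (forall i, x i = y i) -> x = y.
Proof. by move=> xy; apply/val_inj/funext. Qed.

Lemma l2sq x : abs_summable (fun i => normc (x i) ^+ 2).
Proof. by apply/asboolP; exact: (l2_summable x). Qed.

Definition csum (f : I -> R[i]) : R[i] :=
  (rsum (fun i => complex.Re (f i)) +i* rsum (fun i => complex.Im (f i)))%C.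

(* Linear in the first argument. *)
Definition dot x y : R[i] := csum (fun i => x i * (y i)^*).

Definition nsq x : R := rsum (fun i => normc (x i) ^+ 2).

Definition l2norm x : R := Num.sqrt (nsq x).

Lemma summable_Re x y : abs_summable (fun i => complex.Re (x i * (y i)^*)).
Proof.
apply: (le_abs_summable (fun i => abs_Re_mulJ_le (x i) (y i))).
by apply: abs_summableD; exact: l2sq.
Qed.

Lemma summable_Im x y : abs_summable (fun i => complex.Im (x i * (y i)^*)).
Proof.
apply: (le_abs_summable (fun i => abs_Im_mulJ_le (x i) (y i))).
by apply: abs_summableD; exact: l2sq.
Qed.

Lemma dotDl x y z : dot (x + y) z = dot x z + dot y z.
Proof.
rewrite /dot /csum; apply/eqP; rewrite eq_complex /=; apply/andP; split; apply/eqP.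
  rewrite -rsumD; [|exact: summable_Re..].
  by congr rsum; apply/funext => i; rewrite -ReD -mulrDl.
rewrite -rsumD; [|exact: summable_Im..].
by congr rsum; apply/funext => i; rewrite -ImD -mulrDl.
Qed.

Lemma dotC x y : dot y x = (dot x y)^*.
Proof.
rewrite /dot /csum /=; apply/eqP; rewrite eq_complex /=; apply/andP; split; apply/eqP.
  by congr rsum; apply/funext => i; case: (x i) (y i) => [a b] [c d] /=; ring.
rewrite -rsumN.
by congr rsum; apply/funext => i; case: (x i) (y i) => [a b] [c d] /=; ring.
Qed.

Lemma dotDr x y z : dot x (y + z) = dot x y + dot x z.
Proof. by rewrite dotC dotDl conjcD -!dotC. Qed.

Lemma dotZl a x y : dot (a *: x) y = a * dot x y.
Proof.
rewrite /dot /csum; apply/eqP; rewrite eq_complex; apply/andP; split; apply/eqP.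
  transitivity (complex.Re a * rsum (fun i => complex.Re (x i * (y i)^*)) +
     - (complex.Im a * rsum (fun i => complex.Im (x i * (y i)^*)))); last by case: a.
  rewrite -!rsumZ; [|exact: summable_Im|exact: summable_Re].
  rewrite -rsumN -rsumD; first last.
  - by apply: abs_summableN; apply: abs_summableZ; exact: summable_Im.
  - by apply: abs_summableZ; exact: summable_Re.
  congr rsum; apply/funext => i; rewrite l2Z -mulrA.
  by case: (_ * _^*) => c d; case: a.
transitivity (complex.Re a * rsum (fun i => complex.Im (x i * (y i)^*)) +
     complex.Im a * rsum (fun i => complex.Re (x i * (y i)^*))); last by case: a.
rewrite -!rsumZ; [|exact: summable_Re|exact: summable_Im].
rewrite -rsumD; first last.
- by apply: abs_summableZ; exact: summable_Re.
- by apply: abs_summableZ; exact: summable_Im.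
congr rsum; apply/funext => i; rewrite l2Z -mulrA.
by case: (_ * _^*) => c d; case: a.
Qed.

Lemma dotZr a x y : dot x (a *: y) = a^* * dot x y.
Proof. by rewrite dotC dotZl conjcM [dot x y]dotC. Qed.

Lemma dot0l x : dot 0 x = 0.
Proof. by apply: (addrI (dot 0 x)); rewrite -dotDl !addr0. Qed.

Lemma dot0r x : dot x 0 = 0.
Proof. by rewrite dotC dot0l conjC0. Qed.

Lemma dotNl x y : dot (- x) y = - dot x y.
Proof. by rewrite -scaleN1r dotZl mulN1r. Qed.

Lemma dotNr x y : dot x (- y) = - dot x y.
Proof. by rewrite dotC dotNl conjcN -dotC. Qed.

Lemma dotxx x : dot x x = ((nsq x)%:C)%C.
Proof.
rewrite /dot /csum /nsq; apply/eqP; rewrite eq_complex; apply/andP; split; apply/eqP.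
  congr rsum; apply/funext => i; rewrite sqr_normcE.
  by case: (x i) => a b /=; ring.
rewrite -[RHS]/0 -[RHS](mul0r (rsum (fun i => normc (x i) ^+ 2))) -rsumZ; last exact: l2sq.
by congr rsum; apply/funext => i; case: (x i) => a b /=; ring.
Qed.

Lemma nsq_ge0 x : 0 <= nsq x.
Proof. by apply: ge0_rsum => i; exact: sqr_ge0. Qed.

Lemma nsq_eq0 x : nsq x = 0 -> x = 0.
Proof.
move=> x0; apply: l2P => i; apply: (@eq0_normc R); apply/eqP.
rewrite -sqrf_eq0 eq_le sqr_ge0 andbT -x0 /nsq rsum_ge0E; first last.
- exact: l2sq.
- by move=> j; exact: sqr_ge0.
have fn : (\esum_(j in [set: I]) (normc (x j) ^+ 2)%:E \is a fin_num)%E.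
  have := l2sq x; rewrite /abs_summable summableE.
  by under eq_esum do rewrite gee0_abs ?lee_fin ?sqr_ge0//.
rewrite -lee_fin fineK//; apply: esum_ge; exists [set i].
  by split => //; exact: finite_set1.
by rewrite fsbig_set1.
Qed.

Lemma dot_inj x y : (forall z, dot z x = dot z y) -> x = y.
Proof.
move=> xy; apply/eqP; rewrite -subr_eq0; apply/eqP/nsq_eq0/(@complexI R).
by rewrite -dotxx dotDr dotNr xy subrr.
Qed.

Lemma l2norm_ge0 x : 0 <= l2norm x. Proof. exact: sqrtr_ge0. Qed.

Lemma l2norm_le (M : R) x y : 0 <= M ->
  (l2norm x <= M * l2norm y) = (nsq x <= M ^+ 2 * nsq y).
Proof.
move=> M0; rewrite -[M in LHS](ger0_norm M0) -sqrtr_sqr -sqrtrM ?sqr_ge0//.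
by rewrite /l2norm ler_sqrt// mulr_ge0 ?sqr_ge0 ?nsq_ge0.
Qed.

Lemma nsqD x y : nsq (x + y) <= 2 * (nsq x + nsq y).
Proof.
have sxy := abs_summableD (l2sq x) (l2sq y).
rewrite /nsq -rsumD; [|exact: l2sq..].
rewrite -rsumZ//; apply: le_rsum => [||i]; first exact: l2sq.
  exact: abs_summableZ.
by rewrite l2D sqr_normcD.
Qed.

Lemma nsqZ a x : nsq (a *: x) = normc a ^+ 2 * nsq x.
Proof.
rewrite /nsq -rsumZ; last exact: l2sq.
by congr rsum; apply/funext => i; rewrite l2Z normcM exprMn.
Qed.

Lemma nsq0 : nsq 0 = 0.
Proof. by rewrite -(scale0r (0 : l2 R I)) nsqZ normc0 expr0n mul0r. Qed.

Lemma nsqN x : nsq (- x) = nsq x.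
Proof. by congr rsum; apply/funext => i; rewrite l2N normcN. Qed.

Lemma adjoint_bound (T T' : l2 R I -> l2 R I) (M : R) : 0 < M ->
  (forall x y, dot (T x) y = dot x (T' y)) ->
  (forall x, nsq (T x) <= M * nsq x) -> forall y, nsq (T' y) <= M * nsq y.
Proof.
move=> M0 adj bT y; set z := T (T' y).
have : 2 * complex.Re (dot z y) <= M^-1 * nsq z + M * nsq y.
  rewrite /dot /csum /nsq /= -!rsumZ; first last.
  - exact: summable_Re.
  - exact: l2sq.
  - exact: l2sq.
  rewrite -rsumD; first last.
  - by apply: abs_summableZ; exact: l2sq.
  - by apply: abs_summableZ; exact: l2sq.
  apply: le_rsum => [||i]; last exact: Re_mulJ_le.
  - by apply: abs_summableZ; exact: summable_Re.
  - by apply: abs_summableD; apply: abs_summableZ; exact: l2sq.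
rewrite adj dotxx /=.
have : M^-1 * nsq z <= nsq (T' y) by rewrite ler_pdivrMl//; exact: bT.
by lra.
Qed.

End L2Space.

(* B(l2(I)). The Hilbert space adjoint is carried as data: it exists for every
   bounded operator, is unique (bopP), and its existence forces linearity
   (bopD, bopZ). *)
Record bop (R : realType) (I : choiceType) := BOp {
  bop_fun :> l2 R I -> l2 R I;
  bop_adj : l2 R I -> l2 R I;
  bop_adjP : forall x y, dot (bop_fun x) y = dot x (bop_adj y);
  bop_bounded : exists M : R, forall x, l2norm (bop_fun x) <= M * l2norm x
}.

Section BoundedOperators.
Context {R : realType} {I : choiceType}.
Local Notation B := (bop R I).
Implicit Types (S T : B) (x y : l2 R I).

HB.instance Definition _ := gen_eqMixin B.
HB.instance Definition _ := gen_choiceMixin B.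

Lemma bopP S T : (forall x, S x = T x) -> S = T.
Proof.
move=> ST; have fST : bop_fun S = bop_fun T by apply/funext.
have aST : bop_adj S = bop_adj T.
  by apply/funext => y; apply: dot_inj => z; rewrite -!bop_adjP ST.
case: S T fST aST {ST} => [f f' p q] [g g' p' q'] /= fg fg'.
by rewrite {}fg {}fg' in p q *; congr BOp; exact: Prop_irrelevance.
Qed.

Lemma bop_adjPl T x y : dot (bop_adj T x) y = dot x (T y).
Proof. by rewrite dotC -bop_adjP [RHS]dotC. Qed.

Lemma bopD T x y : T (x + y) = T x + T y.
Proof.
apply: dot_inj => z; rewrite dotDr -!bop_adjPl dotDr //.
Qed.

Lemma bopZ T a x : T (a *: x) = a *: T x.
Proof. by apply: dot_inj => z; rewrite dotZr -!bop_adjPl dotZr. Qed.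

Lemma bopN T x : T (- x) = - T x.
Proof. by rewrite -scaleN1r bopZ scaleN1r. Qed.

Lemma bop_nsq T : exists2 M : R, 0 < M & forall x, nsq (T x) <= M * nsq x.
Proof.
have [M bM] := bop_bounded T; exists ((`|M| + 1) ^+ 2).
  by rewrite exprn_gt0// ltr_pwDr.
move=> x; rewrite -l2norm_le ?addr_ge0//; apply: (le_trans (bM x)).
by rewrite ler_wpM2r ?l2norm_ge0// (le_trans (ler_norm _))// lerDl.
Qed.

Lemma nsq_bounded (f : l2 R I -> l2 R I) :
  (exists2 M : R, 0 <= M & forall x, nsq (f x) <= M * nsq x) ->
  exists M : R, forall x, l2norm (f x) <= M * l2norm x.
Proof.
move=> [M M0 bM]; exists (Num.sqrt M) => x.
by rewrite l2norm_le ?sqrtr_ge0// sqr_sqrtr.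
Qed.

Lemma bop_adj_nsq T : exists2 M : R, 0 < M & forall x, nsq (bop_adj T x) <= M * nsq x.
Proof.
have [M M0 bM] := bop_nsq T; exists M => //.
exact: adjoint_bound (bop_adjP T) bM.
Qed.

Fact bop0_adjP x y :
  dot (0 : l2 R I) y = dot x (0 : l2 R I).
Proof. by rewrite dot0l dot0r. Qed.

Fact bop0_bounded :
  exists M : R, forall x, l2norm (0 : l2 R I) <= M * l2norm x.
Proof.
by exists 0 => x; rewrite l2norm_le// expr0n mul0r nsq0.
Qed.

Definition bop0 : B :=
  @BOp R I (fun=> 0) (fun=> 0) bop0_adjP bop0_bounded.

Fact bop1_adjP x y :
  dot x y = dot x y :> R[i].
Proof. by []. Qed.

Fact bop1_bounded :
  exists M : R, forall x, l2norm (x : l2 R I) <= M * l2norm x.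
Proof.
by exists 1 => x; rewrite mul1r.
Qed.

Definition bop1 : B :=
  @BOp R I id id bop1_adjP bop1_bounded.

Fact bopN_adjP T x y :
  dot (- T x) y = dot x (- bop_adj T y).
Proof. by rewrite dotNl dotNr bop_adjP. Qed.

Fact bopN_bounded T :
  exists M : R, forall x, l2norm (- T x) <= M * l2norm x.
Proof.
apply: nsq_bounded; have [M M0 bM] := bop_nsq T.
by exists M => [|x]; [exact: ltW|rewrite nsqN].
Qed.

Definition bopN_def T : B :=
  @BOp R I (fun x => - T x) (fun x => - bop_adj T x)
    (bopN_adjP T) (bopN_bounded T).

Fact bopD_adjP S T x y :
  dot (S x + T x) y = dot x (bop_adj S y + bop_adj T y).
Proof. by rewrite dotDl dotDr !bop_adjP. Qed.

Fact bopD_bounded S T :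
  exists M : R, forall x, l2norm (S x + T x) <= M * l2norm x.
Proof.
apply: nsq_bounded; have [M M0 bM] := bop_nsq S; have [N N0 bN] := bop_nsq T.
exists (2 * (M + N)) => [|x]; first by rewrite mulr_ge0// addr_ge0// ltW.
rewrite (le_trans (nsqD _ _))// -mulrA ler_pM2l// mulrDl; exact: lerD.
Qed.

Definition bopD_def S T : B :=
  @BOp R I (fun x => S x + T x) (fun x => bop_adj S x + bop_adj T x)
    (bopD_adjP S T) (bopD_bounded S T).

Fact bopM_adjP S T x y :
  dot (S (T x)) y = dot x (bop_adj T (bop_adj S y)).
Proof. by rewrite !bop_adjP. Qed.

Fact bopM_bounded S T :
  exists M : R, forall x, l2norm (S (T x)) <= M * l2norm x.
Proof.
apply: nsq_bounded; have [M M0 bM] := bop_nsq S; have [N N0 bN] := bop_nsq T.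
exists (M * N) => [|x]; first by rewrite mulr_ge0// ltW.
by rewrite (le_trans (bM _))// -mulrA ler_pM2l.
Qed.

Definition bopM_def S T : B :=
  @BOp R I (fun x => S (T x)) (fun x => bop_adj T (bop_adj S x))
    (bopM_adjP S T) (bopM_bounded S T).

Fact bopZ_adjP (a : R[i]) T x y :
  dot (a *: T x) y = dot x (a^* *: bop_adj T y).
Proof. by rewrite dotZl dotZr bop_adjP conjCK. Qed.

Fact bopZ_bounded (a : R[i]) T :
  exists M : R, forall x, l2norm (a *: T x) <= M * l2norm x.
Proof.
apply: nsq_bounded; have [M M0 bM] := bop_nsq T.
exists (normc a ^+ 2 * M) => [|x]; first by rewrite mulr_ge0 ?sqr_ge0// ltW.
by rewrite nsqZ -[leRHS]mulrA; apply: ler_wpM2l; [exact: sqr_ge0|].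
Qed.

Definition bopZ_def (a : R[i]) T : B :=
  @BOp R I (fun x => a *: T x) (fun x => a^* *: bop_adj T x)
    (bopZ_adjP a T) (bopZ_bounded a T).

Fact bop_star_adjP T x y :
  dot (bop_adj T x) y = dot x (T y).
Proof. exact: bop_adjPl. Qed.

Fact bop_star_bounded T :
  exists M : R, forall x, l2norm (bop_adj T x) <= M * l2norm x.
Proof.
apply: nsq_bounded; have [M M0 bM] := bop_adj_nsq T.
by exists M => //; exact: ltW.
Qed.

Definition bop_star T : B :=
  BOp (bop_star_adjP T) (bop_star_bounded T).

Fact bopDA : associative bopD_def.
Proof. by move=> S T U; apply: bopP => x; exact: addrA. Qed.
Fact bopDC : commutative bopD_def.
Proof. by move=> S T; apply: bopP => x; exact: addrC. Qed.
Fact bopD0 : left_id bop0 bopD_def.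
Proof. by move=> S; apply: bopP => x; exact: add0r. Qed.
Fact bopDN : left_inverse bop0 bopN_def bopD_def.
Proof. by move=> S; apply: bopP => x; exact: addNr. Qed.
HB.instance Definition _ := GRing.isZmodule.Build B bopDA bopDC bopD0 bopDN.

Fact bopMA : associative bopM_def.
Proof. by move=> S T U; exact: bopP. Qed.
Fact bopM1l : left_id bop1 bopM_def. Proof. by move=> S; exact: bopP. Qed.
Fact bopM1r : right_id bop1 bopM_def. Proof. by move=> S; exact: bopP. Qed.
Fact bopMDl : left_distributive bopM_def bopD_def.
Proof. by move=> S T U; exact: bopP. Qed.
Fact bopMDr : right_distributive bopM_def bopD_def.
Proof. by move=> S T U; apply: bopP => x; exact: bopD. Qed.
HB.instance Definition _ :=
  GRing.Zmodule_isPzRing.Build B bopMA bopM1l bopM1r bopMDl bopMDr.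

Fact bopZA a b T : bopZ_def a (bopZ_def b T) = bopZ_def (a * b) T.
Proof. by apply: bopP => x; exact: scalerA. Qed.
Fact bopZ1 : left_id 1 bopZ_def.
Proof. by move=> T; apply: bopP => x; exact: scale1r. Qed.
Fact bopZDr : right_distributive bopZ_def +%R.
Proof. by move=> a S T; apply: bopP => x; exact: scalerDr. Qed.
Fact bopZDl T : {morph bopZ_def^~ T : a b / a + b}.
Proof. by move=> a b; apply: bopP => x; exact: scalerDl. Qed.
HB.instance Definition _ :=
  GRing.Zmodule_isLmodule.Build R[i] B bopZA bopZ1 bopZDr bopZDl.

Fact bop_starK : involutive bop_star. Proof. by move=> T; exact: bopP. Qed.
Fact bop_starD : {morph bop_star : S T / S + T}.
Proof. by move=> S T; exact: bopP. Qed.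
Fact bop_starM S T : bop_star (S * T) = bop_star T * bop_star S.
Proof. exact: bopP. Qed.
HB.instance Definition _ :=
  PzRing_isStarRing.Build B bop_starK bop_starD bop_starM.

Lemma bop_addE S T x : (S + T) x = S x + T x. Proof. by []. Qed.
Lemma bop_oppE T x : (- T) x = - T x. Proof. by []. Qed.
Lemma bop_mulE S T x : (S * T) x = S (T x). Proof. by []. Qed.
Lemma bop_scaleE a T x : (a *: T) x = a *: T x. Proof. by []. Qed.
Lemma bop_starE T x y : dot (T x) y = dot x (star T y).
Proof. exact: bop_adjP. Qed.

Lemma bop_scaleAl a S T : a *: (S * T) = (a *: S) * T.
Proof. exact: bopP. Qed.
Lemma bop_scaleAr a S T : a *: (S * T) = S * (a *: T).
Proof. by apply: bopP => x; rewrite bop_scaleE !bop_mulE bop_scaleE bopZ. Qed.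
Lemma star_scale a T : star (a *: T) = a^* *: star T.
Proof. exact: bopP. Qed.

Definition opnorm_le T (e : R) := forall x, l2norm (T x) <= e * l2norm x.

Lemma opnorm_leP T e : 0 <= e ->
  opnorm_le T e <-> forall x, nsq (T x) <= e ^+ 2 * nsq x.
Proof.
by move=> e0; split => H x; [rewrite -l2norm_le|rewrite l2norm_le].
Qed.

Lemma opnorm_le_star T e : 0 < e -> opnorm_le T e -> opnorm_le (star T) e.
Proof.
move=> e0 /(opnorm_leP _ (ltW e0)) H; apply/(opnorm_leP _ (ltW e0)).
by apply: adjoint_bound (bop_adjP T) H; rewrite exprn_gt0.
Qed.

Lemma opnorm_leM S T e f : 0 <= e -> opnorm_le S e -> opnorm_le T f ->
  opnorm_le (S * T) (e * f).
Proof.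
move=> e0 bS bT x; rewrite bop_mulE (le_trans (bS _))// -mulrA.
exact: ler_wpM2l.
Qed.

Lemma opnorm_le_ex T : exists2 M : R, 0 < M & opnorm_le T M.
Proof.
have [M M0 bM] := bop_nsq T; exists (Num.sqrt M); first by rewrite sqrtr_gt0.
by apply/opnorm_leP; [exact: sqrtr_ge0|rewrite sqr_sqrtr// ltW].
Qed.

Lemma opnorm_leD S T e : 0 <= e -> opnorm_le S e -> opnorm_le T e ->
  opnorm_le (S + T) (2 * e).
Proof.
move=> e0 /(opnorm_leP _ e0) bS /(opnorm_leP _ e0) bT.
apply/opnorm_leP; first by rewrite mulr_ge0.
move=> x; rewrite (le_trans (nsqD _ _))//.
have := bS x; have := bT x; rewrite exprMn.
by set u := _ * nsq x; rewrite -[_ * _ * nsq x]mulrA -/u expr2; lra.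
Qed.

Lemma opnorm_leZ a T e : opnorm_le T e -> opnorm_le (a *: T) (normc a * e).
Proof.
move=> bT x; rewrite bop_scaleE -mulrA (le_trans _ (ler_wpM2l (normc_ge0 a) (bT x)))//.
rewrite /l2norm -[normc a in leRHS]ger0_norm ?normc_ge0// -sqrtr_sqr.
by rewrite -sqrtrM ?sqr_ge0// nsqZ.
Qed.

End BoundedOperators.

Record gaction (G : groupType) (X : Type) := GAction {
  gact :> G -> X -> X;
  gact1 : forall x, gact 1%g x = x;
  gactM : forall g h x, gact (g * h)%g x = gact g (gact h x)
}.

Record linfty (R : realType) (X : Type) := LInfty {
  linfty_fun :> X -> R[i];
  linfty_bounded : exists M : R, forall x, normc (linfty_fun x) <= M
}.

Section LInfty.
Context {R : realType} {X : Type}.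
Implicit Types f h : linfty R X.

Lemma linftyP f h : (forall x, f x = h x) -> f = h.
Proof.
case: f h => [f bf] [h bh] /= fh; have {}fh : f = h by apply/funext.
by rewrite {}fh in bf *; congr LInfty; exact: Prop_irrelevance.
Qed.

Fact linfty_indic_bounded (E : set X) :
  exists M : R, forall x, normc (\1_E x : R[i]) <= M.
Proof.
exists 1 => x; rewrite indicE; case: (x \in E); first by rewrite normc1.
by rewrite normc0 ler01.
Qed.

Definition linfty_indic (E : set X) := LInfty (linfty_indic_bounded E).

Fact linfty_mul_bounded f h : exists M : R, forall x, normc (f x * h x) <= M.
Proof.
have [M bM] := linfty_bounded f; have [N bN] := linfty_bounded h.
by exists (M * N) => x; rewrite normcM ler_pM ?normc_ge0.
Qed.

Definition linfty_mul f h := LInfty (linfty_mul_bounded f h).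

Fact linfty_scale_bounded (a : R[i]) f : exists M : R, forall x, normc (a * f x) <= M.
Proof.
have [M bM] := linfty_bounded f; exists (normc a * M) => x.
by rewrite normcM ler_wpM2l ?normc_ge0.
Qed.

Definition linfty_scale a f := LInfty (linfty_scale_bounded a f).

Fact linfty_conj_bounded f : exists M : R, forall x, normc ((f x)^*) <= M.
Proof. by have [M bM] := linfty_bounded f; exists M => x; rewrite normc_conj. Qed.

Definition linfty_conj f := LInfty (linfty_conj_bounded f).

Fact linfty_comp_bounded f (s : X -> X) : exists M : R, forall x, normc (f (s x)) <= M.
Proof. by have [M bM] := linfty_bounded f; exists M. Qed.

Definition linfty_comp f s := LInfty (linfty_comp_bounded f s).

End LInfty.

(* The action on l^oo(X) is (g.f)(x) = f(g^-1 x). Representing l^oo(X) on l2(X)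
   by multiplication, the induced regular representation on
   l2(G, l2(X)) = l2(G * X) is
     (coef_op f xi)(g, x) = (g^-1.f)(x) xi(g, x) = f(g x) xi(g, x),
     (transl_op k xi)(g, x) = xi(k^-1 g, x),
   with transl_op k coef_op f (transl_op k)^* = coef_op (k.f). *)
Section RegularRepresentation.
Context {R : realType} {G : groupType} {X : choiceType}.
Variable act : gaction G X.
Local Notation H := (l2 R (G * X)%type).
Local Notation B := (bop R (G * X)%type).
Implicit Types (f h : linfty R X) (g k : G) (x y : H) (p : G * X) (T : B).

Fact diag_bound (d : G * X -> R[i]) (M : R) x : (forall p, normc (d p) <= M) ->
  forall p, `|normc (d p * x p) ^+ 2| <= M ^+ 2 * normc (x p) ^+ 2.
Proof.
move=> bM p; rewrite ger0_norm ?sqr_ge0// normcM exprMn.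
apply: ler_wpM2r; first exact: sqr_ge0.
by rewrite ler_sqr ?nnegrE ?normc_ge0// (le_trans (normc_ge0 (d p))).
Qed.

Fact coef_summable f x :
  (fun p => f (act p.1 p.2) * x p) \in @square_summable R (G * X)%type.
Proof.
have [M bM] := linfty_bounded f; apply/asboolP.
apply: (le_abs_summable (diag_bound x (fun p => bM (act p.1 p.2)))).
by apply: abs_summableZ; exact: l2sq.
Qed.

Definition coef_fun f x : H := L2 (coef_summable f x).

Fact coef_adjP f x y : dot (coef_fun f x) y = dot x (coef_fun (linfty_conj f) y).
Proof.
rewrite /dot; congr csum; apply/funext => p /=.
by rewrite conjcM conjCK mulrCA mulrA.
Qed.

Fact coef_bounded f :
  exists M : R, forall x, l2norm (coef_fun f x) <= M * l2norm x.
Proof.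
have [M bM] := linfty_bounded f; apply: nsq_bounded; exists (M ^+ 2).
  exact: sqr_ge0.
move=> x; rewrite /nsq -rsumZ; last exact: l2sq.
apply: le_rsum; [exact: (l2sq (coef_fun f x))| |].
  by apply: abs_summableZ; exact: l2sq.
move=> p; apply: le_trans (diag_bound x (fun p => bM (act p.1 p.2)) p).
exact: ler_norm.
Qed.

Definition coef_op f : B := BOp (coef_adjP f) (coef_bounded f).

Let shift g p : G * X := (g^-1 * p.1, p.2)%g.

Let shiftK g : cancel (shift g) (shift g^-1%g).
Proof. by case=> k x; rewrite /shift/= invgK mulVKg. Qed.

Let shift_bij g : bijective (shift g).
Proof.
exists (shift g^-1%g); first exact: shiftK.
by have := shiftK g^-1%g; rewrite invgK.
Qed.

Fact transl_summable g x :
  (fun p => x (g^-1 * p.1, p.2)%g) \in @square_summable R (G * X)%type.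
Proof.
by apply/asboolP; exact: abs_summable_reindex (shift_bij g) (l2sq x).
Qed.

Definition transl_fun g x : H := L2 (transl_summable g x).

Fact transl_adjP g x y : dot (transl_fun g x) y = dot x (transl_fun g^-1%g y).
Proof.
rewrite /dot /csum; congr (_ +i* _)%C.
  rewrite -[RHS](rsum_reindex _ (shift_bij g)); congr rsum; apply/funext => p /=.
  by rewrite invgK mulVKg; case: p.
rewrite -[RHS](rsum_reindex _ (shift_bij g)); congr rsum; apply/funext => p /=.
by rewrite invgK mulVKg; case: p.
Qed.

Fact transl_bounded g :
  exists M : R, forall x, l2norm (transl_fun g x) <= M * l2norm x.
Proof.
exists 1 => x; rewrite mul1r /l2norm /nsq.
by rewrite -[in leRHS](rsum_reindex _ (shift_bij g)).
Qed.

Definition transl_op g : B := BOp (transl_adjP g) (transl_bounded g).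

(* The elements sum_g f_g g of the algebraic crossed product. *)
Definition crossed_sum (s : seq (linfty R X * G)) : B :=
  \sum_(u <- s) coef_op u.1 * transl_op u.2.

(* Operator norm closure of the algebraic crossed product. *)
Definition in_crossed_product : {pred B} := fun T =>
  `[< forall e : R, 0 < e -> exists s, opnorm_le (T - crossed_sum s) e >].

Lemma coef_opM f h : coef_op f * coef_op h = coef_op (linfty_mul f h).
Proof. by apply: bopP => x; apply: l2P => p /=; rewrite mulrA. Qed.

Lemma transl_opM g k : transl_op g * transl_op k = transl_op (g * k)%g.
Proof. by apply: bopP => x; apply: l2P => p /=; rewrite invgM mulgA. Qed.

Lemma transl_coef g f :
  transl_op g * coef_op f = coef_op (linfty_comp f (act g^-1%g)) * transl_op g.
Proof. by apply: bopP => x; apply: l2P => p /=; rewrite gactM. Qed.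

Lemma transl_op1 : transl_op 1%g = 1.
Proof.
by apply: bopP => x; apply: l2P => -[g a] /=; rewrite invg1 mul1g.
Qed.

Lemma coef_op1 : coef_op (linfty_indic setT) = 1.
Proof.
by apply: bopP => x; apply: l2P => p /=; rewrite indicE in_setT mul1r.
Qed.

Lemma star_coef f : star (coef_op f) = coef_op (linfty_conj f).
Proof. exact: bopP. Qed.

Lemma star_transl g : star (transl_op g) = transl_op g^-1%g.
Proof. exact: bopP. Qed.

Lemma scale_coef a f : a *: coef_op f = coef_op (linfty_scale a f).
Proof. by apply: bopP => x; apply: l2P => p; exact: mulrA. Qed.

Lemma crossed_sumD s t : crossed_sum s + crossed_sum t = crossed_sum (s ++ t).
Proof. by rewrite /crossed_sum big_cat. Qed.

Lemma crossed_sumZ a s : exists t, a *: crossed_sum s = crossed_sum t.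
Proof.
exists [seq (linfty_scale a u.1, u.2) | u <- s].
rewrite /crossed_sum big_map scaler_sumr; apply: eq_bigr => u _ /=.
by rewrite bop_scaleAl scale_coef.
Qed.

Lemma crossed_sumM s t : exists w, crossed_sum s * crossed_sum t = crossed_sum w.
Proof.
exists [seq (linfty_mul u.1 (linfty_comp v.1 (act u.2^-1%g)), (u.2 * v.2)%g)
       | u <- s, v <- t].
rewrite /crossed_sum big_allpairs_dep big_distrl; apply: eq_bigr => u _.
rewrite big_distrr; apply: eq_bigr => v _ /=.
by rewrite mulrA -[_ * coef_op v.1]mulrA transl_coef mulrA coef_opM -mulrA transl_opM.
Qed.

Lemma star0 : star (0 : B) = 0.
Proof. by apply: (addrI (star 0)); rewrite -starD !addr0. Qed.

Lemma starN T : star (- T) = - star T.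
Proof. by apply: (addrI (star T)); rewrite -starD !subrr star0. Qed.

Lemma crossed_sum_star s : exists t, star (crossed_sum s) = crossed_sum t.
Proof.
exists [seq (linfty_comp (linfty_conj u.1) (act u.2), u.2^-1%g) | u <- s].
rewrite /crossed_sum big_map (big_morph star (@starD B) star0).
apply: eq_bigr => u _ /=.
by rewrite starM star_coef star_transl transl_coef invgK.
Qed.

Lemma in_crossed_sum s : in_crossed_product (crossed_sum s).
Proof.
apply/asboolP => e e0; exists s; apply/(opnorm_leP _ (ltW e0)) => x.
rewrite subrr; apply: le_trans (mulr_ge0 (sqr_ge0 e) (nsq_ge0 x)).
by rewrite -[leRHS](@nsq0 R (G * X)%type).
Qed.

Lemma in_crossed_coef f : in_crossed_product (coef_op f).
Proof.
rewrite -[coef_op f]mulr1 -transl_op1.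
suff -> : coef_op f * transl_op 1%g = crossed_sum [:: (f, 1%g)].
  exact: in_crossed_sum.
by rewrite /crossed_sum big_seq1.
Qed.

Lemma in_crossed_transl g : in_crossed_product (transl_op g).
Proof.
rewrite -[transl_op g]mul1r -coef_op1.
suff -> : coef_op (linfty_indic setT) * transl_op g = crossed_sum [:: (linfty_indic setT, g)].
  exact: in_crossed_sum.
by rewrite /crossed_sum big_seq1.
Qed.

Fact in_crossed_submod : submod_closed in_crossed_product.
Proof.
split; first by have := in_crossed_sum [::]; rewrite /crossed_sum big_nil.
move=> a S T /asboolP aS /asboolP aT; apply/asboolP => e e0.
have c0 : 0 < 2 * (normc a + 1) by rewrite mulr_gt0// ltr_wpDl ?normc_ge0.
have [s hs] := aS _ (divr_gt0 e0 c0); have [t ht] := aT _ (divr_gt0 e0 (ltr0n _ 2)).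
have [w hw] := crossed_sumZ a s; exists (w ++ t).
rewrite -crossed_sumD -hw.
have -> : a *: S + T - (a *: crossed_sum s + crossed_sum t) =
   a *: (S - crossed_sum s) + (T - crossed_sum t).
  by rewrite scalerBr opprD addrACA.
rewrite -[e](mulfVK (lt0r_neq0 (ltr0n R 2))) mulrC.
apply: opnorm_leD => //; first by rewrite divr_ge0// ltW.
move=> x; apply: (le_trans (opnorm_leZ _ hs _)).
apply: ler_wpM2r; first exact: l2norm_ge0.
have n0 : normc a + 1 != 0 by rewrite gt_eqF// ltr_wpDl ?normc_ge0.
have -> : e / 2 = (normc a + 1) * (e / (2 * (normc a + 1))) by field.
by apply: ler_wpM2r; [rewrite divr_ge0// ltW|rewrite lerDl].
Qed.

Fact in_crossed_star T : in_crossed_product T -> in_crossed_product (star T).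
Proof.
move=> /asboolP aT; apply/asboolP => e e0; have [s hs] := aT _ e0.
have [w hw] := crossed_sum_star s; exists w.
by rewrite -hw -starN -starD; exact: opnorm_le_star.
Qed.

Fact in_crossed_mul S T :
  in_crossed_product S -> in_crossed_product T -> in_crossed_product (S * T).
Proof.
move=> /asboolP aS /asboolP aT; apply/asboolP => e e0.
have [M M0 bM] := opnorm_le_ex T.
have [s hs] : exists s, opnorm_le (S - crossed_sum s) (e / 2 / M).
  by apply: aS; rewrite !divr_gt0.
have [N N0 bN] := opnorm_le_ex (crossed_sum s).
have [t ht] : exists t, opnorm_le (T - crossed_sum t) (e / 2 / N).
  by apply: aT; rewrite !divr_gt0.
have [w hw] := crossed_sumM s t; exists w; rewrite -hw.
have -> : S * T - crossed_sum s * crossed_sum t =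
   (S - crossed_sum s) * T + crossed_sum s * (T - crossed_sum t).
  by rewrite mulrBl mulrBr addrA subrK.
rewrite -[e](mulfVK (lt0r_neq0 (ltr0n R 2))) mulrC.
apply: opnorm_leD; first by rewrite divr_ge0// ltW.
  rewrite -[e / 2](mulfVK (lt0r_neq0 M0)).
  by apply: opnorm_leM => //; rewrite !divr_ge0// ltW.
rewrite -[e / 2](mulfVK (lt0r_neq0 N0)) mulrC.
by apply: opnorm_leM => //; exact: ltW.
Qed.

Fact in_crossed_mulr : mulr_closed in_crossed_product.
Proof.
split; last exact: in_crossed_mul.
by rewrite -transl_op1; exact: in_crossed_transl.
Qed.

HB.instance Definition _ := GRing.isSubmodClosed.Build R[i] B
  in_crossed_product in_crossed_submod.
HB.instance Definition _ := GRing.isMulClosed.Build B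
  in_crossed_product in_crossed_mulr.

End RegularRepresentation.

(* The reduced crossed product of l^oo(X) by G. *)
Record crossed_product (R : realType) (G : groupType) (X : choiceType)
    (act : gaction G X) := CrossedProduct {
  crossed_val : bop R (G * X)%type;
  crossed_valP : crossed_val \in in_crossed_product act
}.

Section CrossedProductTheory.
Context {R : realType} {G : groupType} {X : choiceType}.
Variable act : gaction G X.
Local Notation A := (crossed_product R act).

HB.instance Definition _ := [isSub for @crossed_val R G X act].
HB.instance Definition _ := [Choice of A by <:].
HB.instance Definition _ := [SubChoice_isSubLmodule of A by <:].
HB.instance Definition _ := GRing.SubZmodule_isSubPzRing.Build _ _ A (GRing.subringClosedP _).

Definition crossed_star (a : A) : A :=
  CrossedProduct (in_crossed_star (crossed_valP a)).

Fact crossed_starK : involutive crossed_star.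
Proof. by move=> a; apply: val_inj; exact: starK. Qed.
Fact crossed_starD : {morph crossed_star : a b / a + b}.
Proof. by move=> a b; apply: val_inj; exact: starD. Qed.
Fact crossed_starM a b : crossed_star (a * b) = crossed_star b * crossed_star a.
Proof. by apply: val_inj; exact: starM. Qed.
HB.instance Definition _ :=
  PzRing_isStarRing.Build A crossed_starK crossed_starD crossed_starM.

(* The canonical embedding of l^oo(X). *)
Definition crossed_coef (f : linfty R X) : A :=
  CrossedProduct (in_crossed_coef act f).

Definition crossed_transl (g : G) : A :=
  CrossedProduct (in_crossed_transl act g).

Definition crossed_indic (E : set X) : A := crossed_coef (linfty_indic E).

(* Only the restriction of phi to the positive cone is constrained; its values
   elsewhere are irrelevant. Recall that 0 * +oo = 0 in \bar R. *)
Definition tracial_weight (phi : A -> \bar R) : Prop :=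
  [/\ forall a : A, is_positive a -> (0 <= phi a)%E,
      forall (a b : A) (s t : R), is_positive a -> is_positive b -> 0 <= s -> 0 <= t ->
        phi (s%:C%C *: a + t%:C%C *: b) = (s%:E * phi a + t%:E * phi b)%E &
      forall x : A, phi (star x * x) = phi (x * star x)].

End CrossedProductTheory.

(* lshift and rshift enumerate the first n and the last m indices; both n and m
   are positive since E is non-empty. *)
Definition paradoxical (G : groupType) (X : Type) (act : gaction G X)
    (E : set X) : Prop :=
  E !=set0 /\
  exists (n m : nat) (V : 'I_(n + m) -> set X) (t : 'I_(n + m) -> G),
    [/\ forall k, V k !=set0,
        \bigcup_(i in [set: 'I_n]) V (lshift m i) = E,
        \bigcup_(j in [set: 'I_m]) V (rshift n j) = E,
        trivIset [set: 'I_(n + m)] (fun k => act (t k) @` V k) &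
        forall k, act (t k) @` V k `<=` E].

(* Main.v *)
(** If E is not paradoxical, Hall's theorem for infinite families shows that
    finite subsets of E cannot all double in size under a fixed finite subset
    of G, whence Folner-type subsets F_n of E; averaging over F_n along an
    ultrafilter gives an invariant mean on E. Cutting the union of the countably
    many translates g_i E into pieces, each moved back into E, extends this mean
    to an increasing sequence M_N of finite integrals on l^oo(X) that is
    invariant up to a change of N. The weight is a |-> sup_N M_N(<a e_x, e_x>)
    with e_x = delta_(1,x). The trace identity is clear on the algebraic crossed
    product, where <x^* x e_x, e_x> is a finite sum, but M_N(1) grows with N, so
    the passage to norm limits needs estimates uniform in N: these come from
    cutting down by the indicator of the support of M_N and applying the trace
    identity once more to the algebraic approximants. The weight takes the value
    1 on 1_E, which rules out (ii), and, summed over the diagonal, (iv).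
    Conversely a paradoxical decomposition translates 1_E piecewise onto two
    disjoint subprojections. *)

Require Import Defs.
From mathcomp Require Import all_boot all_order all_algebra.
From mathcomp Require Import finmap.
From mathcomp Require Import boolp classical_sets functions cardinality.
From mathcomp Require Import fsbigop reals constructive_ereal ereal esum numfun.
From mathcomp Require Import filter topology normedtype sequences.
From mathcomp Require Import complex.
From mathcomp Require Import ring lra zify.

Set Implicit Arguments.
Unset Strict Implicit.
Unset Printing Implicit Defensive.

Import Order.TTheory GRing.Theory Num.Theory.
Import numFieldNormedType.Exports.
Import ComplexField.Normc.

Local Open Scope classical_set_scope.
Local Open Scope ring_scope.

(** * Hall's theorem *)

Section InfiniteHall.
Local Open Scope fset_scope.
Local Open Scope nat_scope.
Variables (I J : choiceType).
Implicit Types (N : I -> {fset J}) (F : {fset I}).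

Definition nbrs N F : {fset J} := \bigcup_(i <- F) N i.

Definition hall N := forall F, #|` F| <= #|` nbrs N F|.

Lemma nbrsP N F y : reflect (exists2 i, i \in F & y \in N i) (y \in nbrs N F).
Proof.
apply: (iffP (bigfcupP _ _ _ _)) => [[i /andP[iF _] yi]|[i iF yi]]; exists i => //.
by rewrite iF.
Qed.

Lemma eq_nbrs N N' F : {in F, N =1 N'} -> nbrs N F = nbrs N' F.
Proof.
by move=> NN'; apply/fsetP => y; apply/nbrsP/nbrsP => -[i iF yi];
  exists i => //; rewrite ?NN'// -NN'.
Qed.

Lemma nbrsU N A B : nbrs N (A `|` B) = nbrs N A `|` nbrs N B.
Proof.
apply/fsetP => y; rewrite inE; apply/nbrsP/orP => [[k]|].
  by rewrite inE => /orP[iA|iB] yi; [left|right]; apply/nbrsP; exists k.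
by case=> /nbrsP[i iA yi]; exists i; rewrite // inE iA ?orbT.
Qed.

Lemma nbrs1 N i : nbrs N [fset i] = N i.
Proof.
apply/fsetP => y; apply/nbrsP/idP => [[j /fset1P->//]|yi].
by exists i; rewrite ?inE.
Qed.

Local Notation HF := {N : I -> {fset J} | hall N}.
Let sub (N N' : HF) : bool := `[< forall i, sval N' i `<=` sval N i >].

Let subP (N N' : HF) : reflect (forall i, sval N' i `<=` sval N i) (sub N N').
Proof. exact: asboolP. Qed.

(** Finiteness of each set gives a smallest [sval M i] along the chain. On a finite [F] a single
    member of the chain realises all these minima at once, and [hall] only tests finite [F], so it
    survives in the limit. *)
Lemma hall_chain (N0 : HF) (A : set HF) : total_on A sub ->
  exists M, forall N : HF, A N -> sub N M.
Proof.
move=> Atot; have [->|/set0P A0] := eqVneq A classical_sets.set0.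
  by exists N0.
have pickmin i : exists2 M, A M & forall M', A M' -> sval M i `<=` sval M' i.
  have [M1 AM1] := A0.
  elim/ltn_ind: {M1}(#|` sval M1 i|) {-2}M1 (erefl #|` sval M1 i|) AM1 => k IH M Mk AM.
  have [|/existsNP[M' /not_implyP[AM' /negP nM]]] :=
      pselect (forall M', A M' -> sval M i `<=` sval M' i); first by exists M.
  have M'M : sval M' i `<` sval M i.
    rewrite fproperE nM andbT.
    by have [/subP//|/subP/(_ i)] := Atot _ _ AM AM'; rewrite (negbTE nM).
  by by apply: (IH #|` sval M' i| _ M') => //; rewrite -Mk fproper_ltn_card.
have {}/choice[m /all_and2[Am mmin]] i : exists M, A M /\
    forall M', A M' -> sval M i `<=` sval M' i by have [M] := pickmin i; exists M.
pose N1 i := sval (m i) i.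
have fin F : exists2 M, A M & {in F, sval M =1 N1}.
  elim/finSet_rect: F => F IH; have [->|[i iF]] := fset_0Vmem F.
    by have [M AM] := A0; exists M.
  have [M AM MF] := IH _ (fproperD1 iF).
  have [/subP mM|/subP Mm] := Atot _ _ AM (Am i).
    exists (m i) => // j jF; apply/eqP; rewrite eqEfsubset mmin// andbT.
    have [->//|ji] := eqVneq j i.
    by rewrite -[N1 j]MF ?mM// !inE ji jF.
  exists M => // j jF; have [->|ji] := eqVneq j i; last by rewrite MF// !inE ji.
  by apply/eqP; rewrite eqEfsubset Mm mmin.
have hN1 : hall N1.
  by move=> F; have [M _ /eq_nbrs<-] := fin F; exact: (svalP M).
by exists (exist _ N1 hN1) => N AN; apply/subP => i; exact: mmin.
Qed.

Let del N i a : I -> {fset J} := fun j => if j == i then N j `\ a else N j.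

Let del_out N i a F : i \notin F -> nbrs (del N i a) F = nbrs N F.
Proof.
move=> iF; apply: eq_nbrs => j jF; rewrite /del; case: eqVneq => // ji.
by rewrite -ji jF in iF.
Qed.

(** A set violating the condition after the deletion must contain [i], since the other sets of the
    family are unchanged; [F] is that set without [i]. *)
Let del_fail N i a : hall N -> ~ hall (del N i a) ->
  exists2 F, i \notin F & #|` nbrs N F `|` (N i `\ a)| <= #|` F|.
Proof.
move=> hN /existsNP[F /negP]; rewrite -ltnNge => ltF.
have iF : i \in F.
  by apply: contraTT ltF => iF; rewrite del_out// -leqNgt hN.
exists (F `\ i); first by rewrite !inE eqxx.
rewrite -(@del_out N i a) ?inE ?eqxx//.
suff -> : nbrs (del N i a) (F `\ i) `|` (N i `\ a) = nbrs (del N i a) F.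
  by rewrite (cardfsD1 i F) iF in ltF; lia.
rewrite -{2}(fsetD1K iF) fsetUC nbrsU nbrs1 /del eqxx//.
Qed.

(* Rado: in a minimal family satisfying the marriage condition every set is a
   singleton. *)
Lemma hall_matching N : hall N ->
  exists h : I -> J, injective h /\ forall i, h i \in N i.
Proof.
move=> hN; pose N0 : HF := exist _ N hN.
pose T := {M : HF | sub N0 M}.
have [||||M Mmin] := @Zorn T (fun M M' => sub (sval M) (sval M')).
- by move=> M; exact/subP.
- move=> M M' M'' /subP MM' /subP M'M''; apply/subP => i.
  exact: fsubset_trans (M'M'' i) (MM' i).
- move=> [[M hM] sM] [[M' hM'] sM'] /subP/= MM' /subP/= M'M; do 2 apply: eq_exist.
  by apply/funext => i; apply/eqP; rewrite eqEfsubset M'M MM'.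
- move=> A Atot; have [->|/set0P[M1 AM1]] := eqVneq A classical_sets.set0.
    by exists (exist _ N0 (introT (subP _ _) (fun=> fsubset_refl _))).
  have [] := @hall_chain N0 [set M | exists2 M', A M' & sval M' = M]%classic.
    by move=> _ _ [M AM <-] [M' AM' <-]; exact: Atot.
  move=> M MA; have N0M : sub N0 M.
    apply/subP => i; have /subP/(_ i) := MA _ (ex_intro2 _ _ M1 AM1 erefl).
    by move=> /fsubset_trans; apply; move/subP: (svalP M1).
  by exists (exist _ M N0M) => M' AM'; apply: MA; exists M'.
set P := sval (sval M).
have hP : hall P := svalP (sval M).
have uniqP i a b : a \in P i -> b \in P i -> a = b.
  have nd c : c \in P i -> ~ hall (del P i c).
    move=> cP hd; have sd : sub (sval M) (exist _ _ hd).
      by apply/subP => j; rewrite /del/=; case: eqP => // _; exact: fsubD1set.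
    have s0 : sub N0 (exist _ _ hd).
      apply/subP => j; move/subP: sd => /(_ j)/fsubset_trans; apply.
      by move/subP: (svalP M).
    have := Mmin (exist (fun M => is_true (sub N0 M)) _ s0) sd.
    move=> /(congr1 (fun M : T => sval (sval M) i))/=.
    rewrite /del eqxx => /fsetP/(_ c); rewrite !inE eqxx/= => /esym.
    by rewrite -/P cP.
  move=> aP bP; apply/eqP/negP => /negP ab.
  have [A iA lA] := del_fail hP (nd _ aP); have [B iB lB] := del_fail hP (nd _ bP).
  (* Here $|U\cup V|+|U\cap V|\le|A|+|B|$. As $a\ne b$, the union contains all neighbours of
     $\{i\}\cup A\cup B$, hence at least $|A\cup B|+1$ elements, and the intersection has at least
     $|A\cap B|$: a contradiction. *)
  set U := nbrs P A `|` _ in lA; set V := nbrs P B `|` _ in lB.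
  have le1 : #|` nbrs P (i |` (A `|` B))| <= #|` U `|` V|.
    apply/fsubset_leq_card/fsubsetP => y; rewrite !nbrsU nbrs1 !inE.
    by case: (eqVneq y a) => [->|]; rewrite ?ab ?eqxx/=; do ![case: (_ \in _)].
  have le2 : #|` nbrs P (A `&` B)| <= #|` U `&` V|.
    apply/fsubset_leq_card/fsubsetP => y /nbrsP[j]; rewrite inE => /andP[jA jB] yj.
    by rewrite !inE; apply/andP; split; apply/orP; left; apply/nbrsP; exists j.
  have := cardfsUI U V; have := cardfsUI A B.
  have := hP (i |` (A `|` B)); have := hP (A `&` B).
  rewrite cardfsU1 !inE (negbTE iA) (negbTE iB)/=.
  by move: le1 le2 lA lB; lia.
have ex i : exists y, y \in P i.
  apply/fset0Pn; rewrite -cardfs_gt0; have := hP [fset i].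
  by rewrite nbrs1 cardfs1.
have /choice[h hPh] := ex.
exists h; split; last by move=> i; move/subP: (svalP M) => /(_ i)/fsubsetP; exact.
move=> i j hij; apply/eqP/negP => /negP ij.
have := hP [fset i; j]; rewrite cardfs2 ij.
have /fsubset_leq_card : nbrs P [fset i; j] `<=` [fset h i].
  apply/fsubsetP => y; rewrite nbrsU !nbrs1 !inE => /orP[yi|yj].
    by rewrite (uniqP _ _ _ yi (hPh i)).
  by rewrite (uniqP _ _ _ yj (hPh j)) hij.
by rewrite cardfs1; case: #|`_| => [|[|]].
Qed.

End InfiniteHall.

(** * Folner sets from the failure of paradoxicality *)

Section Folner.
Context {G : groupType} {X : choiceType}.
Variables (act : gaction G X) (E : set X).

Lemma act_inj g : injective (act g).
Proof.
by move=> x y /(congr1 (act g^-1%g)); rewrite -!gactM mulVg !gact1.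
Qed.

Section Piecewise.
Variables (S : seq G) (t : X -> bool -> G).
Hypotheses (E0 : E !=set0) (tS : forall x b, E x -> t x b \in S).
Hypothesis tE : forall x b, E x -> E (act (t x b) x).
Hypothesis t_inj : forall x b y c, E x -> E y ->
  act (t x b) x = act (t y c) y -> x = y /\ b = c.

Let W b g : set X := [set x | E x /\ t x b = g].
Let L b := [seq g <- undup S | `[< W b g !=set0 >]].

Let L_uniq b : uniq (L b). Proof. exact/filter_uniq/undup_uniq. Qed.

Let W0 b g : g \in L b -> W b g !=set0.
Proof. by rewrite mem_filter => /andP[/asboolP]. Qed.

Let W_cover b : E = \bigcup_(i in [set: 'I_(size (L b))]) W b (nth 1%g (L b) i).
Proof.
apply/seteqP; split => [x Ex|x [i _ []//]].
have tL : t x b \in L b.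
  by rewrite mem_filter mem_undup tS// andbT; apply/asboolP; exists x.
have ltL : (index (t x b) (L b) < size (L b))%N by rewrite index_mem.
by exists (Ordinal ltL) => //; split => //=; rewrite nth_index.
Qed.

(** The pieces are the level sets of [t], one family for each boolean. Each family covers [E], and
    joint injectivity makes all translates disjoint. [L] drops unattained labels, which give empty
    pieces, and repeated ones, which give equal translates. *)
Lemma paradoxical_piecewise : paradoxical act E.
Proof.
split => //; exists (size (L true)), (size (L false)).
pose lab (k : 'I_(size (L true) + size (L false))) := match fintype.split k with
  | inl i => (true, nth 1%g (L true) i)
  | inr j => (false, nth 1%g (L false) j) end.
exists (fun k => W (lab k).1 (lab k).2), (fun k => (lab k).2); split.
- move=> k; rewrite /lab; case: fintype.split => i /=; apply: W0; exact: mem_nth.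
- rewrite [RHS](W_cover true); apply: eq_bigcupr => i _.
  by rewrite /lab (unsplitK (inl i)).
- rewrite [RHS](W_cover false); apply: eq_bigcupr => i _.
  by rewrite /lab (unsplitK (inr i)).
- move=> k l _ _ [y [[x [Ex tx] xy] [x' [Ex' tx'] xy']]].
  have [xx' bb] : x = x' /\ (lab k).1 = (lab l).1.
    by apply: t_inj => //; rewrite tx tx' xy.
  have {tx tx'} gg : (lab k).2 = (lab l).2 by rewrite -tx -tx' xx' bb.
  move: bb gg; rewrite -[k]splitK -[l]splitK /lab !unsplitK.
  by case: (fintype.split k) => i; case: (fintype.split l) => j //= _ /eqP;
    rewrite nth_uniq// => /eqP /val_inj ->.
- by move=> k _ [x [Ex <-] <-]; exact: tE.
Qed.

End Piecewise.

Local Open Scope fset_scope.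
Local Open Scope nat_scope.
Implicit Types (S T : seq G) (F : {fset X}).

Definition inE_nbr S x : {fset X} := [fset y in [seq act s x | s <- S] | y \in E].

Lemma inE_nbrP S x y :
  reflect ((exists2 s, s \in S & y = act s x) /\ E y) (y \in inE_nbr S x).
Proof.
rewrite !inE/=; apply: (iffP andP) => [[/mapP h /set_mem]//|[h Ey]].
by split; [exact/mapP|exact/mem_set].
Qed.

Lemma inE_nbrsP S F y :
  reflect (exists x s, [/\ x \in F, s \in S, y = act s x & E y])
    (y \in nbrs (inE_nbr S) F).
Proof.
apply: (iffP (nbrsP _ _ _)) => [[x xF /inE_nbrP[[s sS yE] Ey]]|[x [s [xF sS yE Ey]]]].
  by exists x, s.
by exists x => //; apply/inE_nbrP; split => //; exists s.
Qed.

(** Doubling is the marriage condition for two copies of [E], each point being allowed to move by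
    [T] inside [E]. A matching is thus a pair of piecewise translations of [E] into itself with
    disjoint images. *)
Lemma doubling_paradoxical T : E !=set0 ->
  (forall F, ([set` F] `<=` E)%classic -> 2 * #|` F| <= #|` nbrs (inE_nbr T) F|) ->
  paradoxical act E.
Proof.
move=> E0 dbl; pose I := ({x : X | x \in E} * bool)%type.
have [|h [hinj hT]] := @hall_matching I X (fun i => inE_nbr T (val i.1)).
  move=> F; pose F' : {fset X} := [fset val i.1 | i in F].
  have -> : nbrs (fun i : I => inE_nbr T (val i.1)) F = nbrs (inE_nbr T) F'.
    apply/fsetP => y; apply/nbrsP/nbrsP => [[i iF yi]|[x /imfsetP[/= i iF ->] yx]].
      by exists (val i.1) => //; apply/imfsetP; exists i.
    by exists i.
  have dblF : #|` [fset (x, true) | x in F'] `|` [fset (x, false) | x in F']|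
      <= 2 * #|` F'|.
    rewrite cardfsU (leq_trans (leq_subr _ _))// mul2n -addnn.
    by apply: leq_add; exact: leq_imfset_card.
  apply: leq_trans (dbl F' _); last first.
    by move=> x /= /imfsetP[i _ ->]; apply: set_mem; exact: valP.
  have /fsubset_leq_card : [fset (val i.1, i.2) | i in F] `<=`
      [fset (x, true) | x in F'] `|` [fset (x, false) | x in F'].
    apply/fsubsetP => _ /imfsetP[/= [i b] iF ->]; rewrite inE.
    have iF' : val i \in F' by apply/imfsetP; exists (i, b).
    by apply/orP; case: b {iF}; [left|right]; apply/imfsetP; exists (val i).
  rewrite card_imfset => [/leq_trans->//|[x b] [y c] /= [/val_inj-> ->//]].
have {}hT x b (xE : x \in E) : exists2 g, g \in T & h (exist _ x xE, b) = act g x /\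
    E (act g x).
  by have /inE_nbrP[[g gT ->] Eg] := hT (exist _ x xE, b); exists g.
have /choice[t tP] (xb : X * bool) : exists g : G, forall xE : xb.1 \in E,
    [/\ g \in T, h (exist _ xb.1 xE, xb.2) = act g xb.1 & E (act g xb.1)].
  case: xb => x b /=; have [xE|nxE] := pselect (x \in E);
    last by exists 1%g => xE; case: nxE.
  have [g gT [hg Eg]] := hT x b xE; exists g => xE'; split => //.
  by rewrite -hg; congr (h (exist _ _ _, _)); exact: Prop_irrelevance.
apply: (@paradoxical_piecewise T (fun x b => t (x, b))) => //.
- by move=> x b /mem_set xE; case: (tP (x, b) xE).
- by move=> x b /mem_set xE; case: (tP (x, b) xE).
- move=> x b y c /mem_set xE /mem_set yE.
  by have [_ /= <- _] := tP (x, b) xE; have [_ /= <- _] := tP (y, c) yE => /hinj[].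
Qed.

(** If every finite set grew by a factor $1+1/m$ under [S], then after $m$ rounds it would grow by
    $(1+1/m)^m\ge2$, and [doubling_paradoxical] would apply. *)
Lemma folner_nat S m : E !=set0 -> ~ paradoxical act E ->
  exists F, [/\ F != fset0, ([set` F] `<=` E)%classic &
    m * #|` nbrs (inE_nbr S) F| <= m.+1 * #|` F|].
Proof.
move=> E0 npar; apply: contrapT => nF.
have {}nF F : ([set` F] `<=` E)%classic -> m.+1 * #|` F| <= m * #|` nbrs (inE_nbr S) F|.
  move=> FE; have [->|F0] := eqVneq F fset0; first by rewrite cardfs0 muln0.
  by rewrite leqNgt; apply/negP => lt; apply: nF; exists F; rewrite ltnW.
have m0 : 0 < m.
  have [x Ex] := E0; have := nF [fset x]; rewrite cardfs1; case: m {nF} => //.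
  by rewrite mul1n mul0n; apply => y /=; rewrite inE => /eqP->.
(* Products of [k] elements of [S]: a path of [k] steps inside [E] is one step by such a product, so
   the growth factors multiply. *)
pose S' k := iter k (fun T => [seq (s * u)%g | s <- S, u <- T]) [:: 1%g].
have iterS k F : ([set` F] `<=` E)%classic ->
    m.+1 ^ k * #|` F| <= m ^ k * #|` nbrs (inE_nbr (S' k)) F|.
  elim: k => [|k IH] FE.
    rewrite !expn0 !mul1n; apply/fsubset_leq_card/fsubsetP => x xF.
    by apply/inE_nbrsP; exists x, 1%g; rewrite gact1 inE; split => //; exact: FE.
  rewrite expnS -mulnA (leq_trans (leq_mul (leqnn _) (IH FE)))//.
  rewrite mulnCA expnSr -mulnA leq_mul// (leq_trans (nF _ _))//.
    by move=> y /= /inE_nbrsP[x [s []]].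
  rewrite leq_mul//; apply/fsubset_leq_card/fsubsetP => z.
  move=> /inE_nbrsP[_ [s [/inE_nbrsP[x [u [xF uS -> _]]] sS -> Ez]]].
  apply/inE_nbrsP; exists x, (s * u)%g; rewrite gactM; split => //.
  by apply/allpairsP; exists (s, u).
apply: npar; apply: (@doubling_paradoxical (S' m)) => // F FE.
(* The first two binomial terms of $(m+1)^m$ are $m^m$ and $m\cdot m^{m-1}$. *)
have mm : 2 * m ^ m <= m.+1 ^ m.
  case: m m0 {nF S' iterS} => // k _; rewrite -[k.+2]addn1 expnDn.
  rewrite big_ord_recl big_ord_recl /= bin0 bin1 !exp1n !muln1 mul1n subn0 subn1/=.
  by rewrite addnA mul2n -addnn {2}expnS leq_addr.
have mm0 : 0 < m ^ m by rewrite expn_gt0 m0.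
rewrite -(leq_pmul2l mm0); apply: leq_trans (iterS m F FE).
by rewrite mulnA leq_mul// mulnC.
Qed.

End Folner.

(** * Invariant means *)

Section GeneralizedLimit.
Context {R : realType}.

Definition bdd {T : Type} (f : T -> R) := exists M, forall x, `|f x| <= M.

Lemma bddW {T : Type} (f h : T -> R) : (forall x, `|f x| <= `|h x|) -> bdd h -> bdd f.
Proof. by move=> fh [M bM]; exists M => x; exact: le_trans (bM x). Qed.

Lemma bddD {T : Type} (f h : T -> R) : bdd f -> bdd h -> bdd (fun x => f x + h x).
Proof.
move=> [M bM] [N bN]; exists (M + N) => x.
exact: le_trans (ler_normD _ _) (lerD _ _).
Qed.

Lemma bddM {T : Type} (f h : T -> R) : bdd f -> bdd h -> bdd (fun x => f x * h x).
Proof.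
by move=> [M bM] [N bN]; exists (M * N) => x; rewrite normrM ler_pM.
Qed.

Lemma bddc {T : Type} (c : R) : bdd (fun=> c : R) (T := T).
Proof. by exists `|c|. Qed.

Lemma bdd_comp {T U : Type} (f : T -> R) (s : U -> T) : bdd f -> bdd (f \o s).
Proof. by move=> [M bM]; exists M => x; exact: bM. Qed.

(** Take the limit along an ultrafilter refining the filter at infinity; bounded sequences converge
    along it because closed intervals are compact. *)
Lemma generalized_limit : exists L : (nat -> R) -> R,
  [/\ forall u v, bdd u -> bdd v -> L (fun n => u n + v n) = L u + L v,
      forall c u, bdd u -> L (fun n => c * u n) = c * L u,
      forall u v n0, bdd u -> bdd v ->
        (forall n, (n0 <= n)%N -> u n <= v n) -> L u <= L v &
      forall u l, bdd u ->
        (forall e, 0 < e -> exists n0, forall n, (n0 <= n)%N -> `|u n - l| <= e) ->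
        L u = l].
Proof.
have [U [UU oU]] := @ultraFilterLemma nat \oo _.
have PU : ProperFilter U by exact: ultra_proper.
exists (fun u => lim (u @ U)).
have cv u : bdd u -> cvg (u @ U).
  move=> [M bM]; have := @segment_compact R (- M) M.
  move=> /(_ (u @ U) _)[|l [_ ul]].
    rewrite /fmap/=; apply: filterE => n /=; by rewrite in_itv/= -ler_norml.
  apply/cvg_ex; exists l => V Vl /=.
  have [//|nV] := in_ultra_setVsetC (u @^-1` V) UU.
  by have [x [nVx /nVx]] := ul (~` V) V nV Vl.
have le u v n0 : bdd u -> bdd v ->
    (forall n, (n0 <= n)%N -> u n <= v n) -> lim (u @ U) <= lim (v @ U).
  move=> bu bv uv; apply: ler_lim; [exact: cv..|].
  by apply: oU; exists n0.
split => //.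
- by move=> u v bu bv; apply: cvg_lim => //; apply: cvgD; exact: cv.
- by move=> c u bu; apply: cvg_lim => //; apply: cvgM; [exact: cvg_cst|exact: cv].
- move=> u l bu ul; apply: cvg_lim => //; apply/cvgrPdist_le => e e0.
  have [n0 hn] := ul _ e0; apply: oU; exists n0 => // n /hn.
  by rewrite distrC.
Qed.
End GeneralizedLimit.

Lemma ler_sum_sub (R : numDomainType) (T : eqType) (s t : seq T) (v : T -> R) :
  uniq s -> uniq t -> (forall y, 0 <= v y) ->
  (forall y, y \in s -> v y != 0 -> y \in t) ->
  \sum_(y <- s) v y <= \sum_(y <- t) v y.
Proof.
move=> us ut v0 st; rewrite (bigID (fun y => v y != 0)) /=.
rewrite [X in _ + X]big1 ?addr0; last by move=> y /negbNE/eqP.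
rewrite [leRHS](bigID (fun y => (y \in s) && (v y != 0))) /=.
rewrite -[leLHS]addr0 lerD ?sumr_ge0// -!(big_filter _ (fun y => _ && _)) -big_filter.
rewrite le_eqVlt; apply/orP; left; apply/eqP/perm_big/uniq_perm; rewrite ?filter_uniq//.
move=> y; rewrite !mem_filter; case: (boolP (y \in s)); rewrite ?andbF ?andbT//= => ys.
by case: (boolP (v y != 0)) => //= /st ->.
Qed.

Section InvariantMean.
Context {R : realType} {G : groupType} {X : choiceType}.
Variables (act : gaction G X) (E : set X) (e : nat -> G).
Hypotheses (e_surj : forall g, exists n, e n = g) (E0 : E !=set0).
Hypothesis npar : ~ paradoxical act E.

Let S n := 1%g :: mkseq e n.

(** Moving the sum by [g] puts the support of the summand inside the neighbours of [F] in [E]. These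
    exceed [F] by at most $|F|/(n+1)$ points, each contributing at most [M]. *)
Lemma ler_sum_folner g n (F : {fset X}) (f : X -> R) (M : R) : g \in S n ->
  [set` F] `<=` E -> (n.+1 * #|` nbrs (inE_nbr act E (S n)) F| <= n.+2 * #|` F|)%N ->
  (forall x, 0 <= f x <= M) -> (forall x, f x != 0 -> E (act g x)) ->
  \sum_(x <- F) f x <= \sum_(x <- F) f (act g^-1%g x) + M * (#|` F|%:R * n.+1%:R^-1).
Proof.
move=> gS FE FF f0M fE; set v := fun x => f (act g^-1%g x).
have actK : cancel (act g) (act g^-1%g) by move=> x; rewrite -gactM mulVg gact1.
have v0 x : 0 <= v x by have /andP[] := f0M (act g^-1%g x).
set B := nbrs _ F in FF.
have FB : {subset F <= B}.
  move=> x xF; apply/inE_nbrsP; exists x, 1%g; rewrite gact1 mem_head.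
  by split => //; exact: FE.
apply: (@le_trans _ _ (\sum_(y <- B) v y)).
  rewrite (eq_bigr (fun x => v (act g x))); last by move=> x _; rewrite /v actK.
  rewrite -(big_map (act g) xpredT v); apply: ler_sum_sub => //.
    by rewrite map_inj_uniq//; exact: act_inj.
  move=> _ /mapP[x xF ->]; rewrite /v actK => /fE Egx.
  by apply/inE_nbrsP; exists x, g.
rewrite (bigID (mem F)) /= lerD//.
  rewrite -big_filter; apply: ler_sum_sub => //; first exact: filter_uniq.
  by move=> y; rewrite mem_filter => /andP[].
have M0 : 0 <= M by have [x _] := E0; have /andP[] := f0M x; exact: le_trans.
apply: (@le_trans _ _ (\sum_(y <- B | y \notin F) M)).
  by apply: ler_sum => y _; have /andP[] := f0M (act g^-1%g y).
rewrite big_const_seq iter_addr_0 -[_ *+ _]mulr_natr ler_wpM2l//.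
rewrite ler_pdivlMr ?ltr0n// -natrM ler_nat.
have := count_predC (mem F) B.
have : (#|` F| <= count (mem F) B)%N.
  rewrite -size_filter; apply: uniq_leq_size => // x xF.
  by rewrite mem_filter; apply/andP; split => //; exact: FB.
move: FF; rewrite -[size B]/(#|` B|).
have -> : count (fun y => y \notin F) B = count (predC (mem F)) B by [].
by nia.
Qed.

(** Averages over the Folner sets, taken along a generalized limit. Invariance is one-sided:
    [h \o act t] is supported in [E], whereas the part of [h \o act s] outside [E] has no mass. *)
Lemma invariant_mean : exists m : (X -> R) -> R,
  [/\ forall f h, bdd f -> bdd h -> m (fun x => f x + h x) = m f + m h,
      forall c f, bdd f -> m (fun x => c * f x) = c * m f,
      forall f, bdd f -> (forall x, 0 <= f x) -> 0 <= m f,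
      m \1_E = 1 &
      forall s t h, bdd h -> (forall x, 0 <= h x) ->
        (forall x, h x != 0 -> E (act t^-1%g x)) -> m (h \o act s) <= m (h \o act t)].
Proof.
have /choice[F /all_and3[F0 FE FF]] n := folner_nat (S n) n.+1 E0 npar.
have cF n : 0 < #|` F n|%:R :> R by rewrite ltr0n cardfs_gt0.
have [L [LD LZ Lle Llim]] := @generalized_limit R.
pose u (f : X -> R) n := (#|` F n|%:R)^-1 * \sum_(x <- F n) f x.
have ub f : bdd f -> bdd (u f).
  move=> [M bM]; exists M => n; rewrite /u normrM ger0_norm ?invr_ge0//.
  rewrite ler_pdivrMl// (le_trans (ler_norm_sum _ _ _))//.
  rewrite (le_trans (ler_sum _ (fun x _ => bM x)))//.
  by rewrite big_const_seq count_predT iter_addr_0 mulr_natl.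
exists (fun f => L (u f)); split.
- move=> f h bf bh; rewrite -LD//; try exact: ub.
  by congr L; apply/funext => n; rewrite /u -mulrDr big_split.
- move=> c f bf; rewrite -LZ//; last exact: ub.
  by congr L; apply/funext => n; rewrite /u mulrCA -mulr_sumr.
- move=> f bf f0; have <- : L (fun=> 0) = 0.
    by apply: Llim => [|e' e0]; [exact: bddc|exists 0%N => n _; rewrite subrr normr0 ltW].
  apply: (Lle _ _ 0%N); [exact: bddc|exact: ub|].
  by move=> n _; rewrite /u mulr_ge0 ?invr_ge0 ?sumr_ge0.
- have -> : u \1_E = fun=> 1.
    apply/funext => n; rewrite /u (eq_big_seq (fun=> 1)).
      by rewrite big_const_seq count_predT iter_addr_0 mulVf ?gt_eqF.
    by move=> x xF; rewrite indicE mem_set//; exact: FE xF.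
  by apply: Llim => [|e' e0]; [exact: bddc|exists 0%N => n _; rewrite subrr normr0 ltW].
- move=> s t h bh h0 hE; have [M bM] := bh.
  set g := (t^-1 * s)%g; have [n0 en0] := e_surj g.
  have ht : h \o act t = (h \o act s) \o act g^-1%g.
    by apply/funext => x /=; rewrite /g -gactM invgM invgK mulVKg.
  (* The error allowed by [ler_sum_folner] on the [n]-th Folner set; its limit is 0, so it may be
     added to the right-hand side. *)
  pose w n : R := M * n.+1%:R^-1.
  have M0 : 0 <= M by have [x _] := E0; exact: le_trans (bM x).
  have bw : bdd w.
    exists M => n; rewrite ger0_norm ?mulr_ge0 ?invr_ge0//.
    by rewrite ler_piMr// invf_le1 ?ltr0n// ler1n.
  have Lw : L w = 0.
    apply: Llim => // e' e0; exists (Num.truncn (M / e')) => n hn.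
    rewrite subr0 ger0_norm ?mulr_ge0 ?invr_ge0// ler_pdivrMr ?ltr0n// mulrC.
    rewrite -ler_pdivrMr//; apply: ltW.
    apply: lt_le_trans (_ : (Num.truncn (M / e')).+1%:R <= _); last by rewrite ler_nat.
    exact: truncnS_gt.
  rewrite -[leRHS]addr0 -Lw -LD//; last by apply: ub; exact: bdd_comp.
  (* [S n] lists [e] only below [n], so [g = e n0] belongs to it from [n0.+1] on. *)
  apply: (Lle _ _ n0.+1).
  - by apply: ub; exact: bdd_comp.
  - by apply: bddD => //; apply: ub; exact: bdd_comp.
  move=> n hn; rewrite /u -(ler_pM2l (cF n)) mulVKf ?gt_eqF// mulrDr mulVKf ?gt_eqF//.
  rewrite /w mulrCA ht; apply: (@ler_sum_folner g n) => //.
  + by rewrite inE -en0 map_f ?orbT// mem_iota.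
  + by move=> x; rewrite h0/= (le_trans (ler_norm _)).
  + by move=> x /= /hE; rewrite -gactM.
Qed.

End InvariantMean.

(* M N f is the integral of f over Q N, a finite union of translates of E. *)
Record layered_mean (R : realType) (G : groupType) (X : choiceType)
    (act : gaction G X) (E : set X) (M : nat -> (X -> R) -> R)
    (Q : nat -> set X) : Prop := LayeredMean {
  lmeanD : forall N f h, bdd f -> bdd h -> M N (fun x => f x + h x) = M N f + M N h;
  lmeanZ : forall N c f, bdd f -> M N (fun x => c * f x) = c * M N f;
  lmean_ge0 : forall N f, bdd f -> (forall x, 0 <= f x) -> 0 <= M N f;
  lmean_homo : forall N N' f, bdd f -> (forall x, 0 <= f x) -> (N <= N')%N ->
    M N f <= M N' f;
  lmean_restr : forall N f, M N (fun x => \1_(Q N) x * f x) = M N f;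
  lmean_restr_le : forall N K f, bdd f -> (forall x, 0 <= f x) ->
    M N (fun x => \1_(Q K) x * f x) <= M K f;
  lmean1_le : forall N, M N (fun=> 1) <= N%:R;
  lmean_act : forall c N, exists N', forall f, bdd f -> (forall x, 0 <= f x) ->
    M N (f \o act c) <= M N' f;
  lmean_indic : forall N, M N.+1 \1_E = 1
}.

(** * Extension of the invariant mean to the translates of [E] *)

Section LayeredMeanExists.
Context {R : realType} {G : groupType} {X : choiceType}.
Variables (act : gaction G X) (E : set X) (e : nat -> G) (m : (X -> R) -> R).
Hypotheses (e_surj : forall g, exists n, e n = g) (e0 : e 0%N = 1%g).
Hypothesis mD : forall f h, bdd f -> bdd h -> m (fun x => f x + h x) = m f + m h.
Hypothesis mZ : forall c f, bdd f -> m (fun x => c * f x) = c * m f.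
Hypothesis m_ge0 : forall f, bdd f -> (forall x, 0 <= f x) -> 0 <= m f.
Hypothesis mE : m \1_E = 1.
Hypothesis m_act : forall s t h, bdd h -> (forall x, 0 <= h x) ->
  (forall x, h x != 0 -> E (act t^-1%g x)) -> m (h \o act s) <= m (h \o act t).

Lemma bdd_indic (A : set X) : bdd (\1_A : X -> R).
Proof.
by exists 1 => x; rewrite indicE; case: (x \in A); rewrite ?normr1 ?normr0 ?ler01.
Qed.
#[local] Hint Resolve bdd_indic : core.

Let indic_ge0 (A : set X) x : 0 <= \1_A x :> R. Proof. by rewrite indicE ler0n. Qed.
#[local] Hint Resolve indic_ge0 : core.

Let m0 : m (fun=> 0) = 0.
Proof.
rewrite -[RHS](mul0r (m (fun=> 0))) -mZ; last exact: bddc.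
by congr m; apply/funext => x; rewrite mul0r.
Qed.

Let m_le f h : bdd f -> bdd h -> (forall x, f x <= h x) -> m f <= m h.
Proof.
move=> bf bh fh; have bN : bdd (fun x => -1 * f x) by apply: bddM => //; exact: bddc.
have -> : h = (fun x => f x + (h x + -1 * f x)) by apply/funext => x; ring.
rewrite mD//; last exact: bddD.
by rewrite lerDl m_ge0// => [|x]; [exact: bddD|have := fh x; lra].
Qed.

Let m_sum (n : nat) (F : 'I_n -> X -> R) : (forall i, bdd (F i)) ->
  bdd (fun x => \sum_i F i x) /\ m (fun x => \sum_i F i x) = \sum_i m (F i).
Proof.
move=> bF; elim: n F bF => [|n IH] F bF.
  split; last by rewrite big_ord0 -[RHS]m0; congr m; apply/funext => x; rewrite big_ord0.
  by exists 0 => x; rewrite big_ord0 normr0.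
have [bS mS] := IH (fun i => F (widen_ord (leqnSn n) i)) (fun=> bF _).
have -> : (fun x => \sum_i F i x) =
    fun x => \sum_(i < n) F (widen_ord (leqnSn n) i) x + F ord_max x.
  by apply/funext => x; rewrite big_ord_recr.
by split; [exact: bddD|rewrite mD// mS big_ord_recr].
Qed.

(** The mean [m] sees only [E]. The sets [D i] are disjoint pieces of the translates $e_iE$, and
    [cell] carries [f] on [D i] back to a function supported in [E], where [m] can be applied. *)
Let Q N : set X := [set x | exists2 i, (i < N)%N & E (act (e i)^-1%g x)].
Let D i : set X := [set x | E (act (e i)^-1%g x) /\ ~ Q i x].
Let cell f i x : R := \1_(D i) (act (e i) x) * f (act (e i) x).
Let M N f := \sum_(i < N) m (cell f i).

Let sumD N x : \sum_(i < N) \1_(D i) x = \1_(Q N) x :> R.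
Proof.
elim: N => [|N IH]; rewrite ?big_ord0 ?big_ord_recr /= ?IH !indicE.
  by rewrite memNset// => -[].
have QS : Q N.+1 x <-> Q N x \/ E (act (e N)^-1%g x).
  split=> [[k]|[[i iN Ei]|EN]]; last 2 first.
  - by exists i => //; exact: ltnW.
  - by exists N.
  by rewrite ltnS leq_eqVlt => /orP[/eqP->|iN] Ei; [right|left; exists k].
have [QN|nQN] := pselect (Q N x).
  rewrite [x \in Q N]mem_set// memNset ?addr0; last by case.
  by rewrite mem_set//; apply/QS; left.
rewrite [x \in Q N]memNset// add0r; congr (nat_of_bool _)%:R.
apply/idP/idP => /set_mem => [[EN _]|/QS[//|EN]]; apply/mem_set => //.
by apply/QS; right.
Qed.

Let bdd_cell f i : bdd f -> bdd (cell f i).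
Proof.
move=> bf; apply: bddM; last exact: bdd_comp.
exact: (bdd_comp (act (e i)) (bdd_indic (D i))).
Qed.

Let cell_ge0 f i : (forall x, 0 <= f x) -> forall x, 0 <= cell f i x.
Proof. by move=> f0 x; rewrite mulr_ge0. Qed.

Let D_Q i N x : (i < N)%N -> D i x -> Q N x.
Proof. by move=> iN [Ei _]; exists i. Qed.

(** The piece $cD_i$ lies in $ce_iE$, again one of the enumerated translates. Cut it along the [D k]
    and use [m_act] to replace the transport by $ce_i$ with that by $e_k$. The $cD_i$ being
    disjoint, the pieces [h i] of [f] add up to at most [f]. *)
Lemma layered_mean_act c N : exists N', forall f, bdd f -> (forall x, 0 <= f x) ->
  M N (f \o act c) <= M N' f.
Proof.
have /choice[j jP] i := e_surj (c * e i)%g.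
(* Larger than every index [j i] of $ce_i$, so [Q N'] contains all the $cD_i$; it does not depend on
   [f]. *)
pose N' := (\max_(i < N) j i).+1; exists N' => f bf f0.
pose h i x := \1_(D i) (act c^-1%g x) * f x.
have bh i : bdd (h i).
  by apply: bddM => //; exact: (bdd_comp (act c^-1%g) (bdd_indic (D i))).
have h0 i x : 0 <= h i x by rewrite mulr_ge0.
have hE (i : 'I_N) x : h i x = \sum_(k < N') \1_(D k) x * h i x.
  rewrite -mulr_suml sumD indicE; have [->|hn0] := eqVneq (h i x) 0.
    by rewrite mulr0.
  suff /mem_set-> : Q N' x by rewrite mul1r.
  move: hn0; rewrite /h indicE; case: (boolP (_ \in _)) => [/set_mem[Ei _] _|].
    by exists (j i); [rewrite ltnS; exact: leq_bigmax|rewrite jP invgM gactM].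
  by rewrite mul0r eqxx.
have bDh i k : bdd (fun x => \1_(D k) x * h i x) by exact: bddM.
have le1 (i : 'I_N) : m (cell (f \o act c) i) <= \sum_(k < N') m (cell (h i) k).
  have -> : cell (f \o act c) i =
     fun x => \sum_(k < N') ((fun z => \1_(D k) z * h i z) \o act (c * e i)%g) x.
    apply/funext => x /=; rewrite -hE /h /cell /=.
    by rewrite gactM -[act c^-1%g _]gactM mulVg gact1.
  have [_ ->] := m_sum (fun k : 'I_N' => bdd_comp (act (c * e i)%g) (bDh i k)).
  apply: ler_sum => k _; rewrite -[cell _ _]/((fun z => \1_(D k) z * h i z) \o act (e k)).
  apply: m_act => // [x|x]; first by rewrite mulr_ge0.
  rewrite indicE; case: (boolP (_ \in _)) => [/set_mem[]//|].
  by rewrite mul0r eqxx.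
rewrite /M (le_trans (ler_sum _ (fun i _ => le1 i)))// exchange_big /=.
apply: ler_sum => k _.
have [bS <-] := m_sum (fun i : 'I_N => bdd_cell k (bh i)).
apply: m_le => // [|x]; first exact: bdd_cell.
rewrite /cell -mulr_sumr ler_wpM2l//.
by rewrite /h -mulr_suml sumD ler_piMl// indicE lern1 leq_b1.
Qed.

Lemma layered_meanP : layered_mean act E M Q.
Proof.
split.
- move=> N f h bf bh; rewrite /M -big_split; apply: eq_bigr => i _ /=.
  by rewrite -mD; [|exact: bdd_cell..]; congr m; apply/funext => x; rewrite /cell mulrDr.
- move=> N c f bf; rewrite /M mulr_sumr; apply: eq_bigr => i _ /=.
  by rewrite -mZ; [|exact: bdd_cell]; congr m; apply/funext => x; rewrite /cell mulrCA.
- by move=> N f bf f0; apply: sumr_ge0 => i _; apply: m_ge0; [exact: bdd_cell|exact: cell_ge0].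
- move=> N N' f bf f0 /subnKC <-; rewrite /M big_split_ord /= lerDl.
  by apply: sumr_ge0 => i _; apply: m_ge0; [exact: bdd_cell|exact: cell_ge0].
- move=> N f; apply: eq_bigr => i _; congr m; apply/funext => x; rewrite /cell mulrCA.
  rewrite mulrA [in LHS]indicE [in LHS]indicE [in RHS]indicE.
  case: (boolP (_ \in D i)) => [/set_mem Dx|]; last by rewrite mulr0.
  by rewrite mem_set ?mulr1//; exact: D_Q Dx.
- move=> N K f bf f0; set f' := fun x => _.
  have bf' : bdd f' by exact: bddM.
  have f'0 x : 0 <= f' x by rewrite mulr_ge0.
  (* From index [K] on the pieces avoid [Q K], so at most the first [K] of them contribute, whatever
     [N] is. *)
  have f'K i : (K <= i)%N -> m (cell f' i) = 0.
    move=> Ki; rewrite -[RHS]m0; congr m; apply/funext => x; rewrite /cell /f'.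
    rewrite mulrA [\1_(D i) _]indicE indicE.
    case: (boolP (_ \in D i)) => [/set_mem[_ nQ]|]; last by rewrite !mul0r.
    rewrite memNset ?mulr0 ?mul0r// => -[j jK Ej]; apply: nQ; exists j => //.
    exact: leq_trans Ki.
  have le i : m (cell f' i) <= m (cell f i).
    apply: m_le; [exact: bdd_cell..|move=> x].
    by rewrite /cell ler_wpM2l// ler_piMl// indicE lern1 leq_b1.
  have [NK|KN] := leqP N K.
    rewrite -(subnKC NK) /M big_split_ord /= -[leLHS]addr0 lerD ?ler_sum//.
    by apply: sumr_ge0 => i _; apply: m_ge0; [exact: bdd_cell|exact: cell_ge0].
  rewrite -(subnKC (ltnW KN)) /M big_split_ord /= [X in _ + X]big1 ?addr0 ?ler_sum//.
  by move=> i _; rewrite f'K//= leq_addr.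
- move=> N; rewrite -[N in leRHS]card_ord -sum1_card natr_sum /M.
  apply: ler_sum => i _.
  apply: (@le_trans _ _ (m \1_E)); last by rewrite mE.
  apply: m_le => // [|x]; first by apply: bdd_cell; exact: bddc.
  rewrite /cell mulr1 !indicE ler_nat; case: (boolP (_ \in D i)) => // /set_mem[].
  by rewrite -gactM mulVg gact1 => /mem_set ->.
- exact: layered_mean_act.
(* As [e 0] is the identity, [D 0] is [E] and all later pieces miss [E]. The successor is needed
   because [M 0] is an empty sum. *)
- move=> N; rewrite /M big_ord_recl /= big1 ?addr0 => [|i _].
    rewrite -mE; congr m; apply/funext => x; rewrite /cell e0 gact1.
    rewrite !indicE; case: (boolP (x \in E)) => [xE|]; last by rewrite mulr0.
    rewrite mem_set ?mulr1//; split; last by case.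
    by rewrite e0 invg1 gact1; exact: set_mem.
  rewrite -m0; congr m; apply/funext => x; rewrite /cell !indicE.
  case: (boolP (_ \in D _)) => [/set_mem[_ nQ]|]; last by rewrite mul0r.
  rewrite memNset ?mulr0// => Ex; apply: nQ; exists 0%N => //.
  by rewrite e0 invg1 gact1.
Qed.

End LayeredMeanExists.

Lemma layered_mean_exists (R : realType) (G : groupType) (X : choiceType)
    (act : gaction G X) (E : set X) :
  countable [set: G] -> E !=set0 -> ~ paradoxical act E ->
  exists (M : nat -> (X -> R) -> R) Q, layered_mean act E M Q.
Proof.
move=> /pfcard_geP[G0|[f]] E0 npar.
  by have : [set: G] 1%g by []; rewrite G0.
pose e n : G := if n is k.+1 then f k else 1%g.
have es g : exists n, e n = g.
  by have [n _ <-] := @surj _ _ _ _ f g I; exists n.+1.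
have [m [mD mZ m_ge0 mE m_act]] := invariant_mean (R := R) es E0 npar.
by have := layered_meanP es erefl mD mZ m_ge0 mE m_act; do 2 eexists; eassumption.
Qed.

(** * Crossed products and their diagonals *)

Section FiniteSupport.
Context {R : realType} {I : choiceType}.
Implicit Types (u : I -> R) (s : seq I) (x y : l2 R I).

Lemma esum_finsupp u s : uniq s -> (forall i, 0 <= u i) ->
  (forall i, u i != 0 -> i \in s) ->
  (\esum_(i in [set: I]) (u i)%:E = (\sum_(i <- s) u i)%:E)%E.
Proof.
move=> us u0 supp; transitivity (\esum_(i in [set` s]) (u i)%:E)%E.
  rewrite [RHS]esum_mkcond; apply: eq_esum => i _ /=.
  case: (boolP (i \in [set` s])) => // /negP nis.
  by apply/eqP; apply: contrapT => /negP ui; apply: nis; apply/mem_set/supp.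
rewrite esum_fset; last by move=> i _; rewrite lee_fin.
  by rewrite -fsbig_seq// sumEFin.
exact: finite_seq.
Qed.

Lemma summable_finsupp u s : uniq s -> (forall i, u i != 0 -> i \in s) ->
  abs_summable u.
Proof.
move=> us supp; rewrite /abs_summable /summable.
change (\esum_(i in [set: I]) (`|u i|)%:E < +oo)%E.
rewrite (esum_finsupp us) ?ltry// => i; rewrite normr_eq0; exact: supp.
Qed.

Lemma rsum_finsupp u s : uniq s -> (forall i, u i != 0 -> i \in s) ->
  rsum u = \sum_(i <- s) u i.
Proof.
move=> us supp; rewrite /rsum !(esum_finsupp us)/= -?sumrB.
- apply: eq_bigr => i _; case: (leP (u i) 0); case: (leP (- u i) 0); lra.
- by move=> i; rewrite le_max lexx orbT.
- move=> i; apply: contraR => ns; have /eqP -> : u i == 0.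
    by apply: contraR ns => /supp.
  by rewrite oppr0 maxxx.
- by move=> i; rewrite le_max lexx orbT.
- move=> i; apply: contraR => ns; have /eqP -> : u i == 0.
    by apply: contraR ns => /supp.
  by rewrite maxxx.
Qed.

Fact ket_summable (i : I) : (fun j => (j == i)%:R) \in @square_summable R I.
Proof.
apply/asboolP; apply: (summable_finsupp (s := [:: i])) => // j.
by rewrite inE; case: (eqVneq j i) => // _; rewrite normc0 expr0n eqxx.
Qed.

Definition ket (i : I) : l2 R I := L2 (ket_summable i).

Lemma nsq_finsupp x s : uniq s -> (forall i, x i != 0 -> i \in s) ->
  nsq x = \sum_(i <- s) normc (x i) ^+ 2.
Proof.
move=> us supp; apply: rsum_finsupp => // i; rewrite sqrf_eq0 => xi; apply: supp.
by apply: contra_neq xi => ->; exact: normc0.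
Qed.

Lemma nsq_ket i : nsq (ket i) = 1.
Proof.
rewrite (nsq_finsupp (s := [:: i])) ?big_seq1 /= ?eqxx ?normc1 ?expr1n// => j.
by rewrite inE /=; case: (eqVneq j i) => //; rewrite eqxx.
Qed.

(** Young's inequality for the cross term. Unlike in [nsqD], the factor of [nsq x] can be made close
    to 1, which passing to norm limits requires. *)
Lemma nsqD_weighted (d : R) x y : 0 < d ->
  nsq (x + y) <= (1 + d) * nsq x + (1 + d^-1) * nsq y.
Proof.
move=> d0; rewrite /nsq -!rsumZ; [|exact: l2sq..].
have s1 := abs_summableZ (1 + d) (l2sq x).
have s2 := abs_summableZ (1 + d^-1) (l2sq y).
rewrite -rsumD//; apply: le_rsum => [||i]; first exact: l2sq.
  exact: abs_summableD.
have := Re_mulJ_le (x i) (y i) (t := d^-1); rewrite invr_gt0 invrK => /(_ d0).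
rewrite l2D !sqr_normcE; case: (x i) (y i) => [a b] [a' b'] /=.
by rewrite !expr2; nra.
Qed.

End FiniteSupport.

(** * Diagonal coefficients in the crossed product and their integrals *)

Section Columns.
Context {R : realType} {G : groupType} {X : choiceType}.
Variable act : gaction G X.
Local Notation H := (l2 R (G * X)%type).
Local Notation B := (bop R (G * X)%type).
Implicit Types (S T : B) (s : seq (linfty R X * G)) (A : set X).

(** This is $\langle T^*Te_x,e_x\rangle$ with $e_x=\delta_{(1,x)}$, the value at [x] of the
    canonical conditional expectation of $T^*T$ onto $\ell^\infty(X)$. *)
Definition col T (x : X) : R := nsq (T (ket (1%g, x))).

Definition indic_op A : B := coef_op act (linfty_indic A).

Definition algebraic T := exists s, T = crossed_sum act s.

Lemma col_ge0 T x : 0 <= col T x. Proof. exact: nsq_ge0. Qed.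

Lemma col_le_opnorm T (e : R) x : 0 <= e -> opnorm_le T e -> col T x <= e ^+ 2.
Proof. by move=> e0 /(opnorm_leP _ e0)/(_ (ket (1%g, x))); rewrite nsq_ket mulr1. Qed.

Lemma bdd_col T : bdd (col T).
Proof.
have [M M0 bM] := bop_nsq T; exists M => x; rewrite ger0_norm ?col_ge0//.
by rewrite (le_trans (bM _))// nsq_ket mulr1.
Qed.

Lemma col_weighted S T (d : R) x : 0 < d ->
  col (S + T) x <= (1 + d) * col S x + (1 + d^-1) * col T x.
Proof. exact: nsqD_weighted. Qed.

Lemma col_indicr T A x : col (T * indic_op A) x = \1_A x * col T x.
Proof.
rewrite /col bop_mulE.
have -> : indic_op A (ket (1%g, x)) = (\1_A x : R[i]) *: ket (1%g, x).
  apply: l2P => -[g y]; rewrite l2Z /=.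
  by case: eqP => [[-> ->]|_]; rewrite ?gact1// !mulr0.
rewrite bopZ nsqZ !indicE; case: (x \in A).
  by rewrite normc1 expr1n.
by rewrite normc0 expr0n.
Qed.

Lemma col_indicl_le T A x : col (indic_op A * T) x <= col T x.
Proof.
rewrite /col bop_mulE; apply: le_rsum => [||p]; [exact: l2sq..|].
rewrite /= normcM exprMn ler_piMl ?sqr_ge0// indicE.
by case: (_ \in A); rewrite ?normc1 ?expr1n// normc0 expr0n ler01.
Qed.

Lemma star_indic_op A : star (indic_op A) = indic_op A.
Proof.
rewrite star_coef; congr coef_op; apply: linftyP => x /=.
by rewrite indicE; case: (x \in A); rewrite ?conjC1 ?conjC0.
Qed.

Lemma algebraic_indic A : algebraic (indic_op A).
Proof.
exists [:: (linfty_indic A, 1%g)]; rewrite /crossed_sum big_seq1 /=.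
by rewrite (transl_op1 (R := R)) mulr1.
Qed.

Lemma algebraicM S T : algebraic S -> algebraic T -> algebraic (S * T).
Proof.
move=> [s ->] [t ->]; have [w ->] := crossed_sumM act s t; by exists w.
Qed.

Let entryE (J : Type) (r : seq J) (F : J -> B) (y : H) p :
  (\sum_(j <- r) F j) y p = \sum_(j <- r) F j y p.
Proof. exact: (big_morph (fun T : B => T y p)). Qed.

Let eqVg1 (a b : G) : ((a^-1 * b)%g == 1%g) = (a == b).
Proof.
by apply/eqP/eqP => [ab|->]; [apply: (mulgI a^-1%g); rewrite mulVg ab|rewrite mulVg].
Qed.

(** The list [s] may repeat a group element, so its coefficient collects all occurrences. *)
Let Fcoef s g z : R[i] := \sum_(u <- s | u.2 == g) u.1 z.

Let Fcoef0 s g z : g \notin map snd s -> Fcoef s g z = 0.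
Proof.
move=> gs; rewrite /Fcoef big_hasC//; apply: contra gs => sg.
by rewrite -has_pred1 has_map; apply: sub_has sg => u /= /eqP->.
Qed.

(** For $T=\sum_g f_g g$ one has $Te_x=\sum_g f_g(gx)\delta_{(g,x)}$, whereas
    $T^*e_x=\sum_g\overline{f_g(x)}\delta_{(g^{-1},x)}$. The two columns thus differ, term by term,
    only by the substitution of $gx$ for $x$. *)
Lemma col_crossed_sum s x : col (crossed_sum act s) x =
  \sum_(g <- undup (map snd s)) normc (Fcoef s g (act g x)) ^+ 2.
Proof.
have valE p : crossed_sum act s (ket (1%g, x)) p =
    (p.2 == x)%:R * Fcoef s p.1 (act p.1 x).
  rewrite /crossed_sum entryE /Fcoef mulr_sumr [RHS]big_mkcond.
  apply: eq_bigr => u _ /=; case: p => g y /=; rewrite xpair_eqE eqVg1.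
  case: (u.2 == g); last by rewrite mulr0.
  by case: (eqVneq y x) => [->|]; rewrite ?mulr1 ?mul1r// mulr0 mul0r.
have inj : injective (fun g : G => (g, x)) by move=> g h [].
rewrite /col (nsq_finsupp (s := [seq (g, x) | g <- undup (map snd s)])).
- rewrite big_map; apply: eq_bigr => g _.
  by rewrite valE /= eqxx mul1r.
- by rewrite map_inj_uniq// undup_uniq.
- case=> g y; rewrite valE /=; case: (eqVneq y x) => [->|]; last by rewrite mul0r eqxx.
  move=> h; rewrite mem_map// mem_undup; apply: contraR h => gs.
  by rewrite Fcoef0// mulr0.
Qed.

Lemma col_star_crossed_sum s x : col (star (crossed_sum act s)) x =
  \sum_(g <- undup (map snd s)) normc (Fcoef s g x) ^+ 2.
Proof.
have valE p : star (crossed_sum act s) (ket (1%g, x)) p =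
    (p.2 == x)%:R * (Fcoef s p.1^-1%g x)^*.
  rewrite /crossed_sum (big_morph star (@starD B) (@star0 _ _ _)) entryE.
  rewrite /Fcoef (big_morph _ (@conjcD R) (@conjC0 _)) mulr_sumr [RHS]big_mkcond.
  apply: eq_bigr => u _ /=; case: p => g y /=; rewrite xpair_eqE invgK.
  have -> : ((u.2 * g)%g == 1%g) = (u.2 == g^-1%g) 
    by rewrite -[u.2 in LHS]invgK eqVg1 -(inj_eq invg_inj) invgK.
  case: (eqVneq u.2 g^-1%g) => [->|]; last by rewrite mulr0.
  by case: (eqVneq y x) => [->|]; rewrite ?mulr0 ?mul0r// mulr1 mul1r mulVg gact1.
have inj : injective (fun g : G => (g^-1%g, x)) by move=> g h [] /invg_inj.
rewrite /col (nsq_finsupp (s := [seq (g^-1%g, x) | g <- undup (map snd s)])).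
- rewrite big_map; apply: eq_bigr => g _.
  by rewrite valE /= eqxx mul1r normc_conj invgK.
- by rewrite map_inj_uniq// undup_uniq.
- case=> g y; rewrite valE /=; case: (eqVneq y x) => [->|]; last by rewrite mul0r eqxx.
  move=> h; rewrite -[g]invgK mem_map// mem_undup; apply: contraR h => gs.
  by rewrite Fcoef0// conjC0 mulr0.
Qed.

Section Integration.
Context {E : set X} {M : nat -> (X -> R) -> R} {Q : nat -> set X}.
Hypothesis lM : layered_mean act E M Q.

Definition mu N T : R := M N (col T).

Lemma layered_mean_le N f h : bdd f -> bdd h -> (forall x, f x <= h x) ->
  M N f <= M N h.
Proof.
move=> bf bh fh; have bN : bdd (fun x => -1 * f x) by apply: bddM => //; exact: bddc.
have -> : h = (fun x => f x + (h x + -1 * f x)) by apply/funext => x; ring.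
rewrite (lmeanD lM)//; last exact: bddD.
by rewrite lerDl (lmean_ge0 lM)// => [|x]; [exact: bddD|have := fh x; lra].
Qed.

Lemma mu_homo N N' T : (N <= N')%N -> mu N T <= mu N' T.
Proof. by apply: (lmean_homo lM) => [|x]; [exact: bdd_col|exact: col_ge0]. Qed.

Lemma mu_weighted N S T (d : R) : 0 < d ->
  mu N (S + T) <= (1 + d) * mu N S + (1 + d^-1) * mu N T.
Proof.
move=> d0; rewrite /mu -!(lmeanZ lM); [|exact: bdd_col..].
have b1 : bdd (fun x => (1 + d) * col S x) by apply: bddM; [exact: bddc|exact: bdd_col].
have b2 : bdd (fun x => (1 + d^-1) * col T x) by apply: bddM; [exact: bddc|exact: bdd_col].
rewrite -(lmeanD lM)//; apply: layered_mean_le => [||x].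
- exact: bdd_col.
- exact: bddD.
- exact: col_weighted.
Qed.

Lemma mu_opnorm N T (e : R) : 0 <= e -> opnorm_le T e -> mu N T <= e ^+ 2 * N%:R.
Proof.
move=> e0 Te; apply: (@le_trans _ _ (M N (fun=> e ^+ 2 * 1))).
  apply: layered_mean_le => [||x]; [exact: bdd_col|exact: bddc|].
  by rewrite mulr1; exact: col_le_opnorm.
rewrite (lmeanZ lM); last exact: bddc.
by rewrite ler_wpM2l ?sqr_ge0// (lmean1_le lM).
Qed.

Lemma mu_indicr N T : mu N (T * indic_op (Q N)) = mu N T.
Proof.
rewrite /mu -[RHS](lmean_restr lM); congr (M N); apply/funext => x.
exact: col_indicr.
Qed.

(** Cutting down on the right by [Q K] makes the integral bounded independently of the stage [N];
    all uniform estimates rest on this. *)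
Lemma mu_indicr_le N K T : mu N (T * indic_op (Q K)) <= mu K T.
Proof.
have -> : mu N (T * indic_op (Q K)) = M N (fun x => \1_(Q K) x * col T x).
  by congr (M N); apply/funext => x; exact: col_indicr.
by apply: (lmean_restr_le lM) => [|x]; [exact: bdd_col|exact: col_ge0].
Qed.

Lemma mu_indicl_le N A T : mu N (indic_op A * T) <= mu N T.
Proof.
by apply: layered_mean_le => [||x]; [exact: bdd_col..|exact: col_indicl_le].
Qed.

Lemma lmean_sum_act N (r : seq G) (a : G -> X -> R) :
  (forall g, bdd (a g)) -> (forall g x, 0 <= a g x) ->
  exists N', M N (fun x => \sum_(g <- r) a g (act g x)) <=
             M N' (fun x => \sum_(g <- r) a g x).
Proof.
move=> ba a0.
have b0 (I : Type) (t : seq I) (F : I -> X -> R) : (forall j, bdd (F j)) ->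
    bdd (fun x => \sum_(j <- t) F j x).
  move=> bF; elim: t => [|j t IH].
    by exists 0 => x; rewrite big_nil normr0.
  have [C bC] := bddD (bF j) IH; exists C => x; rewrite big_cons; exact: bC.
have bact k : bdd (fun x => a k (act k x)) by exact: (bdd_comp (act k)).
elim: r => [|g r [N1 IH]].
  exists N; apply: layered_mean_le => [||x]; [exact: b0 bact|exact: b0 ba|].
  by rewrite !big_nil.
have [N2 H2] := lmean_act lM g N; have {}H2 := H2 _ (ba g) (a0 g).
exists (maxn N1 N2).
have consE (h : G -> X -> X) : (fun x => \sum_(k <- g :: r) a k (h k x)) =
    fun x => a g (h g x) + \sum_(k <- r) a k (h k x).
  by apply/funext => x; rewrite big_cons.
rewrite (consE act) (consE (fun _ x => x)).
rewrite (lmeanD lM)//; last exact: b0 bact.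
rewrite (lmeanD lM)//; last exact: b0 ba.
apply: lerD.
  by apply: (le_trans H2); apply: (lmean_homo lM) => //; exact: leq_maxr.
apply: (le_trans IH); apply: (lmean_homo lM) => [|x|]; [exact: b0 ba| |exact: leq_maxl].
exact: sumr_ge0.
Qed.

(** The two column formulas reduce this to moving finitely many functions by group elements, each at
    the price of a larger stage. *)
Lemma mu_algebraic N T : algebraic T -> exists N', mu N T <= mu N' (star T).
Proof.
move=> [s ->]; pose a g x := normc (Fcoef s g x) ^+ 2.
have le_col g x : (g \in undup (map snd s)) -> a g x <= col (star (crossed_sum act s)) x.
  move=> gs; rewrite col_star_crossed_sum (bigD1_seq g) ?undup_uniq//= lerDl.
  by apply: sumr_ge0 => h _; exact: sqr_ge0.
have ba g : bdd (a g).
  have [gs|gs] := boolP (g \in map snd s); last first.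
    by exists 0 => x; rewrite /a Fcoef0// normc0 expr0n normr0.
  apply: bddW (bdd_col (star (crossed_sum act s))) => x.
  by rewrite !ger0_norm ?col_ge0 ?sqr_ge0// le_col// mem_undup.
have [|N' H] := @lmean_sum_act N (undup (map snd s)) a ba; first by move=> *; exact: sqr_ge0.
exists N'; rewrite /mu.
have -> : col (crossed_sum act s) = fun x => \sum_(g <- undup (map snd s)) a g (act g x).
  by apply/funext => x; exact: col_crossed_sum.
have -> : col (star (crossed_sum act s)) = fun x => \sum_(g <- undup (map snd s)) a g x.
  by apply/funext => x; exact: col_star_crossed_sum.
exact: H.
Qed.

End Integration.
End Columns.

(** * The trace inequality for norm limits of algebraic elements *)

Section Trace.
Context {R : realType} {G : groupType} {X : choiceType}.
Variables (act : gaction G X) (E : set X).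
Variables (M : nat -> (X -> R) -> R) (Q : nat -> set X).
Hypothesis lM : layered_mean act E M Q.
Local Notation B := (bop R (G * X)%type).
Local Notation mu := (@mu R G X M).
Local Notation indic_op := (indic_op act).
Local Notation in_crossed := (in_crossed_product act).
Implicit Types (S T : B).

Let opnorm_leN T (e : R) : opnorm_le T e -> opnorm_le (- T) e.
Proof. by move=> Te x; rewrite bop_oppE /l2norm nsqN; exact: Te. Qed.

Let natr_ge0 n : 0 <= n%:R :> R. Proof. exact: ler0n. Qed.

(* The bound is uniform in N, although mu N of bounded operators is not. *)
Lemma mu_indic_star_le T (e : R) K N : in_crossed T -> 0 < e -> opnorm_le T e ->
  mu N (indic_op (Q K) * star T) <= 10 * K.+1%:R * e ^+ 2.
Proof.
move=> /asboolP aT e0 Te.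
have N0 : 0 < N.+1%:R :> R by rewrite ltr0n.
(* [mu N] of an error of norm $e/(N+1)$ is at most $e^2N/(N+1)^2\le e^2$, which absorbs the growth
   of [M N] of the constant 1. *)
have d0 : 0 < e / N.+1%:R by rewrite divr_gt0.
have [s ST] := aT _ d0; set S := crossed_sum act s in ST.
have de : e / N.+1%:R <= e by rewrite ler_pdivrMr// ler_peMr ?ler1n// ltW.
have STe : opnorm_le (T - S) e.
  by move=> x; rewrite (le_trans (ST x))// ler_wpM2r ?l2norm_ge0.
have Se : opnorm_le S (2 * e).
  have -> : S = T + - (T - S) by rewrite opprB addrCA subrr addr0.
  by apply: opnorm_leD; [exact: ltW|exact: Te|exact: opnorm_leN].
have -> : indic_op (Q K) * star T =
    indic_op (Q K) * star S + indic_op (Q K) * star (T - S).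
  by rewrite -mulrDr -starD addrCA subrr addr0.
(* The trace inequality for algebraic elements puts the indicator on the right, where it limits the
   integral to [Q K], of mass at most [K], at every stage. *)
have h1 : mu N (indic_op (Q K) * star S) <= K%:R * (2 * e) ^+ 2.
  have -> : indic_op (Q K) * star S = star (S * indic_op (Q K)).
    by rewrite starM star_indic_op.
  have aS : algebraic act (star (S * indic_op (Q K))).
    rewrite starM star_indic_op; apply: algebraicM; first exact: algebraic_indic.
    by have [t ->] := crossed_sum_star act s; exists t.
  have [N' /le_trans->//] := mu_algebraic lM N aS.
  rewrite starK (le_trans (mu_indicr_le lM _ _ _))// mulrC.
  by apply: (mu_opnorm lM) => //; rewrite mulr_ge0// ltW.
have h2 : mu N (indic_op (Q K) * star (T - S)) <= e ^+ 2.
  rewrite (le_trans (mu_indicl_le lM _ _ _))//.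
  apply: le_trans (mu_opnorm lM _ (ltW d0) (opnorm_le_star d0 ST)) _.
  rewrite exprMn -mulrA ler_piMr ?sqr_ge0// exprVn mulrC ler_pdivrMr ?exprn_gt0// mul1r.
  by rewrite -natrX ler_nat expnS expn1; nia.
(* With weight 1 both terms are doubled: $8Ke^2+2e^2\le10(K+1)e^2$. *)
have := mu_weighted lM N (indic_op (Q K) * star S) (indic_op (Q K) * star (T - S)) ltr01.
rewrite invr1 => /le_trans->//.
rewrite exprMn in h1; rewrite -[K.+1%:R]natr1.
have := sqr_ge0 e; have := natr_ge0 K; move: h1 h2; move: (K%:R : R) (e ^+ 2) => k q.
by nra.
Qed.

(** Replace [T] by an algebraic [S], apply [mu_algebraic], and return from $S^*$ to $T^*$. The
    second replacement happens at a stage [N'] that depends on [S], so its error must be bounded by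
    [N] alone. *)
Lemma mu_star_le T s : in_crossed T -> (forall N, mu N (star T) <= s) ->
  forall N, mu N T <= s.
Proof.
move=> aT; have /asboolP apT := aT => Ts N.
have s0 : 0 <= s.
  by apply: le_trans (Ts 0%N); apply: (lmean_ge0 lM) => [|x]; [exact: bdd_col|exact: col_ge0].
have step (d e : R) : 0 < d -> 0 < e -> mu N T <=
    (1 + d) * ((1 + d) * s + (1 + d^-1) * (10 * N.+1%:R * e ^+ 2)) +
    (1 + d^-1) * (e ^+ 2 * N%:R).
  move=> d0 e0; have [t ST] := apT _ e0; set S := crossed_sum act t in ST.
  have dV0 : 0 <= 1 + d^-1 by rewrite addr_ge0// invr_ge0 ltW.
  have d10 : 0 <= 1 + d by rewrite addr_ge0// ltW.
  have {1}-> : T = S + (T - S) by rewrite addrCA subrr addr0.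
  apply: le_trans (mu_weighted lM _ _ _ d0) _; apply: lerD; last first.
    by rewrite ler_wpM2l//; apply: (mu_opnorm lM) => //; exact: ltW.
  (* The indicator of [Q N] is inserted for free on the right. After the trace inequality it stands
     on the left, as [mu_indic_star_le] needs to control the error at stage [N']. *)
  rewrite ler_wpM2l// -(mu_indicr lM).
  have aS : algebraic act (S * indic_op (Q N)).
    by apply: algebraicM; [exists t|exact: algebraic_indic].
  have [N' /le_trans->//] := mu_algebraic lM N aS.
  rewrite starM star_indic_op.
  have -> : star S = star T + star (- (T - S)).
    by rewrite -starD opprB addrCA subrr addr0.
  rewrite mulrDr; apply: le_trans (mu_weighted lM _ _ _ d0) _; apply: lerD.
    by rewrite ler_wpM2l// (le_trans (mu_indicl_le lM _ _ _)).
  have aTS : in_crossed (- (T - S)).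
    have TSin : T - S \in in_crossed := rpredB (aT : T \in in_crossed) (in_crossed_sum act t).
    by move: TSin; rewrite -rpredN.
  by rewrite ler_wpM2l//; exact: (mu_indic_star_le N N' aTS e0 (opnorm_leN ST)).
apply/ler_addgt0Pr => eta eta0.
(* Gives $(1+d)^2s\le s+3ds\le s+\eta/2$; the added 1 keeps the denominator positive when [s] is
   0. *)
pose d := Num.min 1 (eta / (6 * s + 1)).
have s1 : 0 < 6 * s + 1 by rewrite ltr_wpDl ?mulr_ge0.
have d0 : 0 < d by rewrite lt_min ltr01 divr_gt0.
have d1 : d <= 1 by rewrite ge_min lexx.
have ds : d * (6 * s + 1) <= eta by rewrite -ler_pdivlMr// ge_min lexx orbT.
(* [c] is the total coefficient of $e^2$ in [step]. Once [d] is fixed, [e] is chosen with $ce^2\le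
   ce\le\eta/2$. *)
pose c := (1 + d) * ((1 + d^-1) * (10 * N.+1%:R)) + (1 + d^-1) * N%:R.
have dV : 0 < d^-1 by rewrite invr_gt0.
have c0 : 0 < c.
  rewrite /c ltr_pwDl//; last by rewrite mulr_ge0// addr_ge0// ltW.
  by rewrite !mulr_gt0 ?addr_gt0 ?ltr0n.
pose e := Num.min 1 (eta / (2 * c)).
have c20 : 0 < 2 * c by rewrite mulr_gt0.
have e0 : 0 < e by rewrite lt_min ltr01 divr_gt0.
have e1 : e <= 1 by rewrite ge_min lexx.
have ec : e * (2 * c) <= eta by rewrite -ler_pdivlMr// ge_min lexx orbT.
apply: le_trans (step d e d0 e0) _.
have -> : (1 + d) * ((1 + d) * s + (1 + d^-1) * (10 * N.+1%:R * e ^+ 2)) +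
    (1 + d^-1) * (e ^+ 2 * N%:R) = (1 + d) * (1 + d) * s + c * e ^+ 2.
  by rewrite /c; ring.
have h1 : c * e ^+ 2 <= c * e by rewrite ler_wpM2l ?(ltW c0)// expr2 ler_piMr// ltW.
have h2 : (1 + d) * (1 + d) * s <= (1 + 3 * d) * s.
  rewrite ler_wpM2r//; have : d * d <= d by rewrite ler_piMr// ltW.
  lra.
lra.
Qed.

(** Otherwise [mu N T - eta] bounds all [mu N' (star T)], hence [mu N T] itself by [mu_star_le]. *)
Lemma mu_star_approx T N (eta : R) : in_crossed T -> 0 < eta ->
  exists N', mu N T <= mu N' (star T) + eta.
Proof.
move=> aT eta0; apply: contrapT => /forallNP h.
suff : mu N T <= mu N T - eta by lra.
apply: mu_star_le => // N'; have /negP := h N'; rewrite -ltNge => /ltW; lra.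
Qed.

End Trace.

(** * The tracial weight *)

Section TracialWeight.
Context {R : realType} {G : groupType} {X : choiceType}.
Variables (act : gaction G X) (E : set X).
Variables (M : nat -> (X -> R) -> R) (Q : nat -> set X).
Hypothesis lM : layered_mean act E M Q.
Local Notation A := (crossed_product R act).
Local Notation mu := (@mu R G X M).
Implicit Types (a b x y : A) (f h : X -> R).

(** The coefficient is already real on the positive cone, by [diag_starM]; the real part only makes
    the function real-valued everywhere. *)
Definition diag a z : R :=
  complex.Re (dot (crossed_val a (ket (1%g, z))) (ket (1%g, z))).

Lemma diagD a b z : diag (a + b) z = diag a z + diag b z.
Proof. by rewrite /diag -ReD -dotDl. Qed.

Lemma diag0 z : diag 0 z = 0.
Proof. by apply: (addrI (diag 0 z)); rewrite -diagD !addr0. Qed.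

Lemma diagZ (s : R) a z : diag (s%:C%C *: a) z = s * diag a z.
Proof.
rewrite /diag.
have -> : crossed_val (s%:C%C *: a) (ket (1%g, z)) = s%:C%C *: crossed_val a (ket (1%g, z)).
  by [].
by rewrite dotZl; case: (dot _ _) => c d /=; rewrite mul0r subr0.
Qed.

Lemma diag_starM b z : diag (star b * b) z = col (crossed_val b) z.
Proof.
rewrite /diag.
have -> : crossed_val (star b * b) (ket (1%g, z)) =
  bop_adj (crossed_val b) (crossed_val b (ket (1%g, z))) by [].
by rewrite bop_adjPl dotxx.
Qed.

Lemma diag_sum (I : Type) (r : seq I) (F : I -> A) z :
  diag (\sum_(i <- r) F i) z = \sum_(i <- r) diag (F i) z.
Proof. exact: (big_morph (fun a => diag a z) (fun a b => diagD a b z) (diag0 z)). Qed.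

Lemma crossed_indic_star (D : set X) : star (crossed_indic act D) = crossed_indic act D :> A.
Proof. by apply: val_inj; exact: (@star_indic_op R). Qed.

Lemma crossed_indicM (D D' : set X) :
  crossed_indic act D * crossed_indic act D' = crossed_indic act (D `&` D') :> A.
Proof.
apply: val_inj => /=; apply: etrans (coef_opM _ _ _) _; congr coef_op.
by apply: linftyP => x /=; rewrite indicI.
Qed.

Lemma diag_indic (D : set X) z : diag (crossed_indic act D) z = \1_D z.
Proof.
rewrite -[D in LHS]setIid -crossed_indicM -{1}crossed_indic_star diag_starM.
rewrite -[crossed_val _]mul1r col_indicr /col.
by rewrite nsq_ket mulr1.
Qed.

Definition lmean_sup f : \bar R := ereal_sup (range (fun N => (M N f)%:E)).

Let lmean_sup_cvg f : bdd f -> (forall z, 0 <= f z) ->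
  (fun N => (M N f)%:E) @ \oo --> lmean_sup f.
Proof.
move=> bf f0; apply: ereal_nondecreasing_cvgn => m n mn.
by rewrite lee_fin; exact: (lmean_homo lM).
Qed.

Let le_lmean_sup N f : ((M N f)%:E <= lmean_sup f)%E.
Proof. by apply: ereal_sup_ubound; exists N. Qed.

Lemma lmean_sup_ge0 f : bdd f -> (forall z, 0 <= f z) -> (0 <= lmean_sup f)%E.
Proof.
move=> bf f0; apply: le_trans (le_lmean_sup 0 f).
by rewrite lee_fin; exact: (lmean_ge0 lM).
Qed.

(** Since [M N] increases with [N] on non-negative functions, the suprema are limits, and limits are
    additive here. *)
Lemma lmean_sup_linear (s t : R) f h : bdd f -> bdd h ->
  (forall z, 0 <= f z) -> (forall z, 0 <= h z) -> 0 <= s -> 0 <= t ->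
  (lmean_sup (fun z => s * f z + t * h z)%R = s%:E * lmean_sup f + t%:E * lmean_sup h)%E.
Proof.
move=> bf bh f0 h0 s0 t0.
have bs : bdd (fun z => s * f z) by apply: bddM => //; exact: bddc.
have bt : bdd (fun z => t * h z) by apply: bddM => //; exact: bddc.
have sth : (0 <= t%:E * lmean_sup h)%E by rewrite mule_ge0 ?lee_fin ?lmean_sup_ge0.
have stf : (0 <= s%:E * lmean_sup f)%E by rewrite mule_ge0 ?lee_fin ?lmean_sup_ge0.
apply: (cvg_unique _ (lmean_sup_cvg _ _)) => //; first exact: bddD.
  by move=> z; rewrite addr_ge0// mulr_ge0.
rewrite (_ : (fun N => _) = (fun N => s%:E * (M N f)%:E) \+ (fun N => t%:E * (M N h)%:E))%E.
  apply: cvgeD; first exact: ge0_adde_def.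
  - by apply: cvgeZl => //; exact: lmean_sup_cvg.
  - by apply: cvgeZl => //; exact: lmean_sup_cvg.
apply/funext => N /=; rewrite (lmeanD lM)// !(lmeanZ lM)//.
Qed.

Definition weight a : \bar R := lmean_sup (diag a).

Lemma weight_starM b : weight (star b * b) = lmean_sup (col (crossed_val b)).
Proof. by congr lmean_sup; apply/funext => z; exact: diag_starM. Qed.

Let weight_trace_le x : (weight (star x * x)%R <= weight (x * star x)%R)%E.
Proof.
have := weight_starM (star x); rewrite starK => ->; rewrite weight_starM.
apply: ge_ereal_sup => _ [N _ <-]; apply/lee_addgt0Pr => e e0.
have [N' le] := mu_star_approx lM N (crossed_valP x) e0.
apply: (@le_trans _ _ ((M N' (col (crossed_val (star x))))%:E + e%:E)%E).
  by rewrite -EFinD lee_fin.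
by rewrite leeD2r.
Qed.

Lemma weight_tracial : tracial_weight weight.
Proof.
split.
- move=> _ [b ->]; rewrite weight_starM; apply: lmean_sup_ge0; first exact: bdd_col.
  by move=> z; exact: col_ge0.
- move=> _ _ s t [b ->] [c ->] s0 t0.
  rewrite !weight_starM -lmean_sup_linear//; try exact: bdd_col;
    try by move=> z; exact: col_ge0.
  by congr lmean_sup; apply/funext => z; rewrite diagD !diagZ !diag_starM.
- move=> x; apply/eqP; rewrite eq_le weight_trace_le/=.
  by rewrite -{1}[x]starK (le_trans (weight_trace_le _))// starK.
Qed.

Lemma weight_indic : weight (crossed_indic act E) = 1%:E.
Proof.
have -> : weight (crossed_indic act E) = lmean_sup \1_E.
  by congr lmean_sup; apply/funext => z; exact: diag_indic.
apply/eqP; rewrite eq_le; apply/andP; split; last first.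
  by have := le_lmean_sup 1%N \1_E; rewrite (lmean_indic lM).
apply: ge_ereal_sup => _ [N _ <-]; rewrite lee_fin -(lmean_indic lM N).
by apply: (lmean_homo lM) => //; exact: bdd_indic.
Qed.

Lemma lmean_sum N (I : Type) (r : seq I) (F : I -> X -> R) :
  (forall i, bdd (F i)) ->
  bdd (fun z => \sum_(i <- r) F i z) /\
  M N (fun z => \sum_(i <- r) F i z) = \sum_(i <- r) M N (F i).
Proof.
move=> bF; elim: r => [|i r [bS IH]].
  have b0 : bdd (fun z : X => \sum_(i <- [::]) F i z).
    by exists 0 => z; rewrite big_nil normr0.
  split=> //; rewrite big_nil.
  rewrite -[RHS](mul0r (M N (fun z => \sum_(i <- [::]) F i z))) -(lmeanZ lM)//.
  by congr (M N); apply/funext => z; rewrite big_nil mul0r.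
have -> : (fun z => \sum_(j <- i :: r) F j z) = fun z => F i z + \sum_(j <- r) F j z.
  by apply/funext => z; rewrite big_cons.
by split; [exact: bddD|rewrite big_cons (lmeanD lM)// IH].
Qed.

Lemma mu_star_approx_sum (I : Type) (r : seq I) (x : I -> A) N (eta : R) : 0 < eta ->
  exists N', \sum_(i <- r) mu N (crossed_val (x i)) <=
    \sum_(i <- r) mu N' (crossed_val (star (x i))) + eta.
Proof.
elim: r eta => [|i r IH] eta eta0.
  by exists N; rewrite !big_nil add0r ltW.
have e2 : 0 < eta / 2 by rewrite divr_gt0.
have [N1 h1] := IH _ e2.
have [N2 h2] := mu_star_approx lM N (crossed_valP (x i)) e2.
exists (maxn N1 N2); rewrite !big_cons.
have h3 := mu_homo lM (star (crossed_val (x i))) (leq_maxr N1 N2).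
have h4 : \sum_(j <- r) mu N1 (crossed_val (star (x j))) <=
    \sum_(j <- r) mu (maxn N1 N2) (crossed_val (star (x j))).
  by apply: ler_sum => j _; apply: (mu_homo lM); exact: leq_maxl.
rewrite -[crossed_val (star (x i))]/(star (crossed_val (x i))).
lra.
Qed.

(** Summing over the diagonal gives a trace worth [n] on the projection. Proper infiniteness would
    fit $xx^*+yy^*$, worth $2n$ up to a small error, under it. The computation stays at finite
    stages, where all quantities are real. *)
Lemma not_properly_infinite_mx n : (0 < n)%N ->
  ~ properly_infinite ((crossed_indic act E)%:M : 'M[A]_n).
Proof.
move=> n0 [_ _ [x [y [_ _ xx yy [b bE]]]]].
have diagP (i : 'I_n) z : diag ((crossed_indic act E)%:M i i : A) z = \1_E z.
  by rewrite mxE eqxx diag_indic.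
have starMii (u : 'M[A]_n) i z : diag ((star u * u) i i) z =
    \sum_k col (crossed_val (u k i)) z.
  rewrite mxE diag_sum; apply: eq_bigr => k _.
  by rewrite mxE diag_starM.
have Mstarii (u : 'M[A]_n) i z : diag ((u * star u) i i) z =
    \sum_k col (crossed_val (star (u i k))) z.
  by rewrite -{1}[u]starK starMii; apply: eq_bigr => k _; rewrite mxE.
have total (u : 'M[A]_n) : star u * u = (crossed_indic act E)%:M ->
    n%:R = \sum_p mu 1 (crossed_val (u p.1 p.2)).
  move=> uu; rewrite -(pair_bigA _ (fun k i => mu 1 (crossed_val (u k i)))) exchange_big /=.
  rewrite -[n in LHS]card_ord -sum1_card natr_sum; apply: eq_bigr => i _.
  rewrite -(lmean_indic lM 0); have [_ <-] := lmean_sum 1 (index_enum 'I_n)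
    (fun k => bdd_col (crossed_val (u k i))).
  by congr (M 1); apply/funext => z; rewrite -starMii uu diagP.
(* A loss of 1/4 for each of [x] and [y] yields $2n\le n+1/2$, impossible for $n\ge1$. *)
have e4 : 0 < 4^-1 :> R by rewrite invr_gt0.
have [N1 hx] := mu_star_approx_sum (index_enum _) (fun p => x p.1 p.2) 1 e4.
have [N2 hy] := mu_star_approx_sum (index_enum _) (fun p => y p.1 p.2) 1 e4.
rewrite -(total x xx) in hx; rewrite -(total y yy) in hy.
(* A common later stage, taken as a successor so that [lmean_indic] gives the value 1 there. *)
pose N := (maxn N1 N2).+1.
have up (u : 'M[A]_n) N' : (N' <= N)%N ->
    \sum_(p : 'I_n * 'I_n) mu N' (crossed_val (star (u p.1 p.2))) <=
    \sum_i \sum_k mu N (crossed_val (star (u i k))).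
  move=> N'N; rewrite (pair_bigA _ (fun i k => mu N (crossed_val (star (u i k))))).
  by apply: ler_sum => p _; apply: (mu_homo lM).
have hx' := up x N1 (leqW (leq_maxl _ _)); have hy' := up y N2 (leqW (leq_maxr _ _)).
have le i : \sum_k mu N (crossed_val (star (x i k))) +
    \sum_k mu N (crossed_val (star (y i k))) <= 1.
  rewrite -(lmean_indic lM (maxn N1 N2)).
  have [bx <-] := lmean_sum N (index_enum 'I_n)
    (fun k => bdd_col (crossed_val (star (x i k)))).
  have [byy <-] := lmean_sum N (index_enum 'I_n)
    (fun k => bdd_col (crossed_val (star (y i k)))).
  rewrite -(lmeanD lM)//; apply: (layered_mean_le lM) => [||z].
  - exact: bddD.
  - exact: bdd_indic.
  rewrite -!Mstarii -(diagP i z) -[(crossed_indic _ _)%:M](subrK (x * star x + y * star y)).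
  have mxD (u v : 'M[A]_n) : (u + v) i i = u i i + v i i by rewrite mxE.
  rewrite bE !mxD !diagD lerDr starMii sumr_ge0// => k _.
  exact: col_ge0.
have : \sum_(i < n) (\sum_k mu N (crossed_val (star (x i k))) +
    \sum_k mu N (crossed_val (star (y i k)))) <= n%:R.
  rewrite -[n in leRHS]card_ord -sum1_card natr_sum.
  by apply: ler_sum => i _; exact: le.
rewrite big_split /=; have : 1 <= n%:R :> R by rewrite ler1n.
lra.
Qed.

End TracialWeight.

(** * Paradoxical decompositions and isometries *)

Section PiecewiseIsometry.
Context {R : realType} {G : groupType} {X : choiceType}.
Variable act : gaction G X.
Local Notation A := (crossed_product R act).
Local Notation indic D := (crossed_indic act D : A).
Local Notation transl g := (crossed_transl act g : A).
Implicit Types (g h : G) (D : set X) (x : A).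

Lemma crossed_translM g h : transl g * transl h = transl (g * h)%g.
Proof. by apply: val_inj; exact: transl_opM. Qed.

Lemma crossed_transl1 : transl 1%g = 1.
Proof. by apply: val_inj; exact: transl_op1. Qed.

Lemma crossed_transl_star g : star (transl g) = transl g^-1%g.
Proof. by apply: val_inj; exact: star_transl. Qed.

Lemma crossed_transl_indic g D : transl g * indic D = indic (act g @` D) * transl g.
Proof.
apply: val_inj; apply: etrans (transl_coef _ _ _) _; congr (coef_op _ _ * _).
apply: linftyP => z /=; rewrite !indicE; congr (nat_of_bool _)%:R.
apply/idP/idP => /set_mem => [Dz|[y Dy <-]]; apply/mem_set.
  by exists (act g^-1%g z) => //; rewrite -gactM mulgV gact1.
by rewrite -gactM mulVg gact1.
Qed.

Lemma crossed_indic_conj g D : transl g * indic D * transl g^-1%g = indic (act g @` D).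
Proof. by rewrite crossed_transl_indic -mulrA crossed_translM mulgV crossed_transl1 mulr1. Qed.

Lemma crossed_indic_sum (I : finType) (D : I -> set X) : trivIset setT D ->
  \sum_i indic (D i) = indic (\bigcup_i D i).
Proof.
move=> tD; apply: val_inj; rewrite raddf_sum /=.
apply: bopP => xi; apply: l2P => p.
rewrite (big_morph (fun T : bop R (G * X)%type => T xi p) (id1 := 0) (op1 := +%R))//=.
rewrite -mulr_suml; congr (_ * _); set z := act p.1 p.2.
have [[i _ Di]|nD] := pselect ((\bigcup_i D i) z).
  rewrite (bigD1 i)//= !indicE !mem_set//; last by exists i.
  rewrite big1 ?addr0// => j ji; rewrite indicE memNset// => Dj.
  by move/eqP: ji; apply; apply: tD => //; exists z.
rewrite indicE memNset// big1// => i _; rewrite indicE memNset// => Di.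
by apply: nD; exists i.
Qed.

Lemma crossed_indic0 : indic set0 = 0.
Proof.
apply: val_inj; apply: bopP => xi; apply: l2P => p /=.
by rewrite indicE memNset// mul0r.
Qed.

Lemma crossed_indicD D D' : D `&` D' = set0 -> indic D + indic D' = indic (D `|` D').
Proof.
move=> DD'; apply: val_inj; apply: bopP => xi; apply: l2P => p /=.
apply: etrans (esym (mulrDl _ _ _)) _; congr (_ * _); rewrite !indicE in_setU.
have := congr1 (fun S => act p.1 p.2 \in S) DD'; rewrite in_setI in_set0.
by case: (_ \in D); case: (_ \in D') => //= _; rewrite ?addr0 ?add0r.
Qed.

(* x translates each V i by t i, so it implements the piecewise translation
   from the union of the V i onto W. *)
Lemma piecewise_isometry n (V : 'I_n -> set X) (t : 'I_n -> G) :
  trivIset setT (fun i => act (t i) @` V i) ->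
  exists x W, [/\ star x * x = indic (\bigcup_i V i), x * star x = indic W &
    W `<=` \bigcup_i act (t i) @` V i].
Proof.
(* The [V i] may overlap, although their translates do not. Keeping each point only in the first
   piece containing it makes the partial isometries [u i] orthogonal on both sides. *)
move=> tV; pose V' i := V i `\` [set z | exists2 j : 'I_n, (j < i)%N & V j z].
pose W i := act (t i) @` V' i.
have tV' : trivIset setT V'.
  move=> i j _ _ [z [[Vi nVi] [Vj nVj]]]; apply: ord_inj.
  by case: (ltngtP i j) => // ij; [case: nVj; exists i|case: nVi; exists j].
have WV i : W i `<=` act (t i) @` V i by move=> _ [z [Vz _] <-]; exists z.
have tW : trivIset setT W.
  by move=> i j _ _ [z [/WV Wi /WV Wj]]; apply: tV => //; exists z.
have V'E : \bigcup_i V' i = \bigcup_i V i.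
  apply/seteqP; split => [z [i _ [Vi _]]|z [i _ Vi]]; first by exists i.
  have [k Vk kmin] := @arg_minnP _ i (fun k => z \in V k) (fun k => k) (mem_set Vi).
  exists k => //; split; first exact: set_mem.
  by move=> [j jk /mem_set/kmin]; rewrite leqNgt jk.
pose u i := transl (t i) * indic (V' i).
have uE i : u i = indic (W i) * transl (t i) by exact: crossed_transl_indic.
have su i : star (u i) = indic (V' i) * transl (t i)^-1%g.
  by rewrite starM crossed_transl_star crossed_indic_star.
have suE i : star (u i) = transl (t i)^-1%g * indic (W i).
  by rewrite uE starM crossed_transl_star crossed_indic_star.
have disj (D : 'I_n -> set X) i j : trivIset setT D -> i != j -> D i `&` D j = set0.
  move=> /trivIsetP tD ij; exact: tD.
have uu i j : star (u i) * u j = if i == j then indic (V' i) else 0.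
  rewrite suE uE mulrA -[_ * indic (W i) * _]mulrA crossed_indicM.
  case: (eqVneq i j) => [<-|ij]; last by rewrite disj// crossed_indic0 mulr0 mul0r.
  rewrite setIid -[X in _ * transl X]invgK crossed_indic_conj; congr (indic _).
  rewrite /W image_comp; apply/seteqP; split=> [_ [z Vz <-]|z Vz].
    by rewrite /= -gactM mulVg gact1.
  by exists z; [exact: Vz|rewrite /= -gactM mulVg gact1].
have uu' i j : u i * star (u j) = if i == j then indic (W i) else 0.
  rewrite su /u mulrA -[_ * indic (V' i) * _]mulrA crossed_indicM.
  case: (eqVneq i j) => [<-|ij]; last by rewrite disj// crossed_indic0 mulr0 mul0r.
  by rewrite setIid crossed_indic_conj.
have s0 : star (0 : A) = 0 by apply: (addrI (star (0 : A))); rewrite -starD !addr0.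
exists (\sum_i u i), (\bigcup_i W i); rewrite (big_morph star (@starD A) s0); split.
- rewrite big_distrl /= -V'E -crossed_indic_sum//; apply: eq_bigr => i _.
  rewrite big_distrr (bigD1 i)//= uu eqxx big1 ?addr0// => j ji.
  by rewrite uu eq_sym (negbTE ji).
- rewrite big_distrl /= -crossed_indic_sum//; apply: eq_bigr => i _.
  rewrite big_distrr (bigD1 i)//= uu' eqxx big1 ?addr0// => j ji.
  by rewrite uu' eq_sym (negbTE ji).
- by move=> z [i _ /WV Vz]; exists i.
Qed.

Lemma paradoxical_isometries (E : set X) : paradoxical act E ->
  exists (x y : A) W W' Z, [/\ star x * x = indic E, star y * y = indic E,
    x * star x = indic W, y * star y = indic W' &
    [/\ W `&` (W' `|` Z) = set0, W' `&` Z = set0 & E = W `|` (W' `|` Z)]].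
Proof.
move=> [E0 [n [m [V [t [V0 VE VE' /trivIsetP tV tE]]]]]].
have [|x [W [xx xW WE]]] := @piecewise_isometry _
  (fun i => V (lshift m i)) (fun i => t (lshift m i)).
  by apply/trivIsetP => i j _ _ ij; apply: tV.
have [|y [W' [yy yW WE']]] := @piecewise_isometry _
  (fun i => V (rshift n i)) (fun i => t (rshift n i)).
  by apply/trivIsetP => i j _ _ ij; apply: tV; rewrite ?eq_rshift.
rewrite VE in xx; rewrite VE' in yy.
exists x, y, W, W', (E `\` (W `|` W')); split => //.
have WW' z : W z -> W' z -> False.
  move=> /WE[i _ Wi] /WE'[j _ Wj].
  have := tV (lshift m i) (rshift n j) I I; rewrite eq_lrshift => /(_ isT).
  by move=> /seteqP[/(_ z)] + _; apply.
have WsE z : W z -> E z by move=> /WE[i _ /tE].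
have WsE' z : W' z -> E z by move=> /WE'[i _ /tE].
split; apply/seteqP; split => z //=.
- by move=> [Wz [/(WW' _ Wz)//|[_ nW]]]; apply: nW; left.
- by move=> [Wz [_ nW]]; apply: nW; right.
- move=> Ez; have [Wz|nW] := pselect (W z); first by left.
  right; have [Wz|nW'] := pselect (W' z); first by left.
  by right; split => // -[].
- by move=> [/WsE//|[/WsE'//|[]]].
Qed.

Lemma crossed_indic_positive D : is_positive (indic D).
Proof. by exists (indic D); rewrite crossed_indic_star crossed_indicM setIid. Qed.

(** The trace property gives [W] and [W'] the same weight $p$ as [E], so $p=p+(p+q)$ with $q\ge0$
    the weight of the remainder [Z]. *)
Lemma paradoxical_weight (E : set X) (phi : A -> \bar R) : paradoxical act E ->
  tracial_weight phi -> phi (indic E) = 0%E \/ phi (indic E) = +oo%E.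
Proof.
move=> /paradoxical_isometries[x [y [W [W' [Z [xx yy xW yW [WZ W'Z EW]]]]]]].
move=> [phi0 phiD phiT].
have add D D' : D `&` D' = set0 ->
    phi (indic (D `|` D')) = (phi (indic D) + phi (indic D'))%E.
  move=> /crossed_indicD <-; have := phiD _ _ 1 1 (crossed_indic_positive D)
    (crossed_indic_positive D') ler01 ler01.
  by rewrite !mul1e !scale1r.
have pW : phi (indic W) = phi (indic E) by rewrite -xW -phiT xx.
have pW' : phi (indic W') = phi (indic E) by rewrite -yW -phiT yy.
have := add _ _ WZ; rewrite -EW (add _ _ W'Z) pW pW'.
have := phi0 _ (crossed_indic_positive E); have := phi0 _ (crossed_indic_positive Z).
case: (phi (indic E)) => [p| |]; case: (phi (indic Z)) => [q| |] //=; try by right.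
rewrite !lee_fin => q0 p0 [pq]; left; congr (_%:E); lra.
Qed.

Lemma crossed_indic_projection D : projection (indic D).
Proof. by split; rewrite ?crossed_indic_star ?crossed_indicM ?setIid. Qed.

Lemma paradoxical_properly_infinite (E : set X) : paradoxical act E ->
  properly_infinite (indic E).
Proof.
move=> parE; have [[z Ez] _] := parE.
have [x [y [W [W' [Z [xx yy xW yW [WZ W'Z EW]]]]]]] := paradoxical_isometries parE.
split; first exact: crossed_indic_projection.
  apply/eqP => /(congr1 (fun a : A => diag a z)); rewrite diag_indic diag0 indicE mem_set//.
  by move/eqP; rewrite oner_eq0.
exists x, y; split => //.
- by rewrite /partial_isometry xx; exact: crossed_indic_projection.
- by rewrite /partial_isometry yy; exact: crossed_indic_projection.
- rewrite xW yW /star_le {1}EW -(crossed_indicD WZ) -(crossed_indicD W'Z).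
  have sub3 (a b c : A) : a + (b + c) - (a + b) = c.
    by rewrite addrA [a + b + c]addrC addrK.
  by rewrite sub3; exact: crossed_indic_positive.
Qed.

End PiecewiseIsometry.

(** * Proper infiniteness in 1 by 1 matrices, and the equivalence *)

Lemma properly_infinite_scalar_mx1 (A : starRingType) (p : A) :
  properly_infinite p -> properly_infinite (p%:M : 'M[A]_1).
Proof.
have sM (a : A) : star (a%:M : 'M[A]_1) = (star a)%:M.
  by apply/matrixP => i j; rewrite !mxE !ord1 eqxx.
have MM (a b : A) : (a%:M : 'M[A]_1) * b%:M = (a * b)%:M by rewrite scalar_mxM.
have MD (a b : A) : (a%:M : 'M[A]_1) + b%:M = (a + b)%:M by rewrite raddfD.
move=> [[sp pp] p0 [x [y [_ _ xx yy [b bE]]]]].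
have proj : projection (p%:M : 'M[A]_1) by split; rewrite ?sM ?MM ?sp ?pp.
split => //.
  apply: contra_neq p0 => /matrixP/(_ ord0 ord0).
  by rewrite !mxE eqxx mulr1n.
exists x%:M, y%:M; split.
- by rewrite /partial_isometry sM MM xx.
- by rewrite /partial_isometry sM MM yy.
- by rewrite sM MM xx.
- by rewrite sM MM yy.
- exists b%:M; rewrite !sM !MM MD -bE; apply/matrixP => i j.
  by rewrite !mxE !ord1 eqxx !mulr1n.
Qed.

Theorem proposition5p5 (R : realType) (G : groupType) (X : choiceType)
    (act : gaction G X) (E : set X) (countableG : countable [set: G])
    (E_neq0 : E !=set0) :
  [<-> paradoxical act E;
       forall phi : crossed_product R act -> \bar R,
         tracial_weight phi ->
         phi (crossed_indic act E) = 0%E \/ phi (crossed_indic act E) = +oo%E;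
       properly_infinite (crossed_indic act E : crossed_product R act);
       exists n : nat, (0 < n)%N /\
         properly_infinite
           ((crossed_indic act E)%:M : 'M[crossed_product R act]_n)].

Proof.
have layered : ~ paradoxical act E -> exists (M : nat -> (X -> R) -> R) Q,
    layered_mean act E M Q by exact: layered_mean_exists.
tfae.
- by move=> parE phi; exact: paradoxical_weight.
(* This implication passes through paradoxicality of [E]: its failure would produce a tracial weight
   with value 1 on $1_E$. *)
- move=> trivial_weights; apply: paradoxical_properly_infinite.
  apply: contrapT => /layered[M [Q lM]].
  have := trivial_weights _ (weight_tracial lM); rewrite (weight_indic lM).
  by case=> // -[] /eqP; rewrite oner_eq0.
- by move=> /properly_infinite_scalar_mx1 ?; exists 1%N.
- move=> [n [n0 infE]]; apply: contrapT => /layered[M [Q lM]].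
  exact: not_properly_infinite_mx lM _ n0 infE.
Qed.
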